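(* The set $$\mathcal T=\{(v_2,v_3,v_4)\in\mathcal M:\{1,v_2,v_3,v_4\}\text{ is a (special) tame basis}\}\subset\mathcal M$$ is a moduli space for the equivalence classes of tame tori. In other words, every tame torus has exactly one representative in $\mathcal T$: for every tame torus $T$ there is exactly one $(v_2,v_3,v_4)\in\mathcal T$ such that $T$ is equivalent to $\mathbb H/(\mathbb Z+\mathbb Zv_2+\mathbb Zv_3+\mathbb Zv_4)$.
   Context: $\mathbb H\cong\mathbb R^4$ is the skew field of quaternions with its Euclidean scalar product $\langle\cdot,\cdot\rangle$, and $\mathbb S=\{q\in\mathbb H: q^2=-1\}$. A function $f:\Omega\to\mathbb H$ on a domain $\Omega\subseteq\mathbb H$ is (slice) regular if for every $I\in\mathbb S$ its restriction $f_I$ to $\Omega\cap(\mathbb R+I\mathbb R)$ has continuous derivatives and $\frac12\left(\frac{\partial}{\partial x}+I\frac{\partial}{\partial y}\right)f_I(x+Iy)=0$. A rank-4 lattice in $\mathbb H$ is the additive subgroup generated by four $\mathbb R$-linearly independent elements (a basis of the lattice). A quaternionic torus is a quotient $T=\mathbb H/L$, $L$ a rank-4 lattice, with the atlas of local inverses of the projection $\pi:\mathbb H\to\mathbb H/L$ on small connected open sets. A map between two quaternionic tori is regular if its expressions in these charts are slice regular; a biregular diffeomorphism is a bijective regular map with regular inverse. Two tori are equivalent if there is a biregular diffeomorphism of one onto the other. Bases are ordered. The Gram matrix of a basis $\{v_1,v_2,v_3,v_4\}$ is $(\langle v_i,v_j\rangle)_{i,j}$. A Gram matrix $R=(r_{i,j})$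 is reduced (in the sense of Minkowski–Siegel) if and only if: B1) $r_{k,k+1}\ge 0$ for $k=1,2,3$; B2) for each $k=1,2,3,4$, $n R\,{}^tn\ge r_{k,k}$ for every $n=(n_1,n_2,n_3,n_4)\in\mathbb Z^4$ such that $\gcd(n_k,\dots,n_4)=1$. $\mathcal R$ is the set of all reduced Gram matrices, regarded as a subset of the space $\mathbb R^{10}$ of real symmetric $4\times4$ matrices. A basis of a lattice is reduced if its Gram matrix is reduced; a special basis is a reduced basis whose first element is $1$; a tame basis is a reduced basis whose Gram matrix is an interior point of $\mathcal R$. Set $\mathcal M=\{(v_2,v_3,v_4)\in\mathbb H^3:\{1,v_2,v_3,v_4\}\text{ is a special basis}\}$. A rank-4 lattice is tame if it has a tame basis; a torus $T$ is tame if there exists a tame lattice $L$ such that $T$ is equivalent to $\mathbb H/L$. *)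

(* Defs.v *)
From HB Require Import structures.
From mathcomp Require Import all_boot all_order all_algebra.
From mathcomp Require Import all_classical all_reals all_analysis.

Set Implicit Arguments.
Unset Strict Implicit.
Unset Printing Implicit Defensive.

Import Order.TTheory GRing.Theory Num.Theory.
Import numFieldNormedType.Exports.

Local Open Scope classical_set_scope.
Local Open Scope ring_scope.
Local Open Scope quotient_scope.

(* The quaternion x0 + x1 i + x2 j + x3 k is the row vector (x0, x1, x2, x3). *)
Notation quat R := 'rV[R]_4 (only parsing).

Section Quaternions.
Context {R : realType}.
Implicit Types p q : quat R.

Definition qmk (a b c d : R) : quat R := \row_(i < 4) [:: a; b; c; d]`_i.

Definition qone : quat R := qmk 1 0 0 0.

Definition qmul p q : quat R :=
  let: (a, b, c, d) := (p 0 0, p 0 1, p 0 2, p 0 3) in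
  let: (a', b', c', d') := (q 0 0, q 0 1, q 0 2, q 0 3) in
  qmk (a * a' - b * b' - c * c' - d * d')
      (a * b' + b * a' + c * d' - d * c')
      (a * c' - b * d' + c * a' + d * b')
      (a * d' + b * c' - c * b' + d * a').

Definition qdot p q : R := \sum_(i < 4) p 0 i * q 0 i.

Definition imag_units : set (quat R) := [set q | qmul q q = - qone].

Definition slice (I : quat R) (z : R * R) : quat R := z.1 *: qone + z.2 *: I.

(* Only the values of f on W matter when W is open, which is the only case in
   which slice_regular is used. *)
Definition slice_regular (W : set (quat R)) (f : quat R -> quat R) : Prop :=
  forall I, imag_units I ->
    let fI := f \o slice I in
    let dx := 'D_((1, 0) : R * R) fI in
    let dy := 'D_((0, 1) : R * R) fI in
    forall z : R * R, W (slice I z) ->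
      [/\ derivable fI z (1, 0) /\ derivable fI z (0, 1),
          {for z, continuous dx} /\ {for z, continuous dy} &
          2^-1 *: (dx z + qmul I (dy z)) = 0].

End Quaternions.

Section Lattices.
Context {R : realType}.

Definition zspan (b : 4.-tuple (quat R)) : {pred quat R} :=
  [pred v | `[< inIntSpan b v >]].

Fact zspan_zmod_closed b : zmod_closed (zspan b).
Proof.
split.
  apply/asboolP; exists [ffun=> 0].
  by rewrite big1 // => i _; rewrite ffunE mulr0z.
move=> _ _ /asboolP[m ->] /asboolP[n ->]; apply/asboolP.
exists [ffun i => m i - n i]; rewrite -sumrB.
by apply: eq_bigr => i _; rewrite ffunE mulrzBr.
Qed.

HB.instance Definition _ b :=
  GRing.isZmodClosed.Build (quat R) (zspan b) (zspan_zmod_closed b).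

Definition lattice_basis (L : zmodClosed (quat R)) (b : 4.-tuple (quat R)) :=
  free b /\ L =i zspan b.

Definition rank4_lattice (L : zmodClosed (quat R)) : Prop :=
  exists b, lattice_basis L b.

Definition gram (b : 4.-tuple (quat R)) : 'M[R]_4 :=
  \matrix_(i, j) qdot (tnth b i) (tnth b j).

Definition symmetric_mx : set 'M[R]_4 := [set A | A^T = A].

Definition minkowski_reduced (A : 'M[R]_4) : Prop :=
  (forall k l : 'I_4, l = k.+1 :> nat -> 0 <= A k l) /\
  (forall (k : 'I_4) (n : 'rV[int]_4),
     \big[gcdn/0]_(i < 4 | (k <= i)%N) absz (n 0 i) = 1%N ->
     A k k <= (map_mx intr n *m A *m (map_mx intr n)^T) 0 0).

Definition reduced_basis (b : 4.-tuple (quat R)) : Prop :=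
  free b /\ minkowski_reduced (gram b).

(* Carries the topology induced on the 10-dimensional space of symmetric
   matrices, so that interior points are taken in that space: as a subset of
   the space of all matrices this set has empty interior. *)
Definition reduced_gram : set (subspace symmetric_mx) :=
  [set A | exists b, reduced_basis b /\ A = gram b].

Definition tame_basis (b : 4.-tuple (quat R)) : Prop :=
  reduced_basis b /\ interior reduced_gram (gram b).

Definition special_basis (b : 4.-tuple (quat R)) : Prop :=
  reduced_basis b /\ tnth b 0 = qone.

Definition tame_lattice (L : zmodClosed (quat R)) : Prop :=
  exists b, lattice_basis L b /\ tame_basis b.

End Lattices.

Definition torus (R : realType) (L : zmodClosed (quat R)) : topologicalType :=
  quotient_topology (Quotient.quot L).

Section Tori.
Context {R : realType}.
Implicit Types L M : zmodClosed (quat R).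

Definition torus_proj L : quat R -> torus L := \pi_(torus L).

(* phi is the inverse, on the image of U, of the restriction of the projection
   to U (in particular the projection is injective on U). *)
Definition torus_chart L (U : set (quat R)) (phi : torus L -> quat R) : Prop :=
  [/\ open U, connected U & {in U, cancel (@torus_proj L) phi}].

(* Continuity makes the domain of every chart expression open; this domain need
   not be connected. *)
Definition regular_map L M (F : torus L -> torus M) : Prop :=
  continuous F /\
  forall U phi V psi, @torus_chart L U phi -> @torus_chart M V psi ->
    slice_regular
      (U `&` [set q | (@torus_proj M @` V) (F (torus_proj L q))])
      (psi \o F \o torus_proj L).

Definition biregular L M (F : torus L -> torus M) : Prop :=
  exists G : torus M -> torus L,
    [/\ cancel F G, cancel G F, regular_map F & regular_map G].

Definition equivalent_tori L M : Prop :=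
  exists F : torus L -> torus M, biregular F.

Definition tame_torus L : Prop :=
  exists M, tame_lattice M /\ equivalent_tori L M.

Definition with_one (v : quat R * quat R * quat R) : 4.-tuple (quat R) :=
  [tuple qone; v.1.1; v.1.2; v.2].

Definition special_moduli : set (quat R * quat R * quat R) :=
  [set v | special_basis (with_one v)].

Definition tame_moduli : set (quat R * quat R * quat R) :=
  special_moduli `&` [set v | tame_basis (with_one v)].

End Tori.

(* Main.v *)
Require Import Defs.
From mathcomp Require Import all_boot all_order all_algebra.
From mathcomp Require Import all_classical all_reals all_analysis.
From mathcomp Require Import ring lra zify.

(** A regular map of tori is affine: it is induced by q |-> q a + b. Indeed let
F be a regular map from H/L to H/M. As H/L is compact and M is discrete, there
is a radius de such that for |q' - q| < de the value of F at the class of q' is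
obtained from its value at the class of q by adding one well-defined small
vector, the increment from q to q'. Fix a slice C_I and s in it with |s| < de.
The increment from z to z + s, as a function of z in C_I, is bounded; it is
moreover holomorphic for the complex structure v |-> I v, because locally it is
the difference of two expressions of F in charts. By the theorem of Liouville it
does not depend on z ([increment_translate]). Hence increments from 0 are
additive in each slice, so they are given by s |-> s a, where a is read off on
the real axis and is therefore the same for all slices ([increment_affine]);
cutting the segment from 0 to q into short pieces gives the formula for F
([regular_torus_map_affine]). Consequently H/L and H/M are equivalent if and only
if M = L a for some a <> 0 ([equivalent_toriP]).

The theorem of Liouville needed here ([liouville_CR]) concerns functions with
continuous partial derivatives. It follows from one circle integral: if u + i w
is holomorphic, Phi r, the real part of the integral of e^(-i t) (u + i w) over
the circle of radius r, satisfies r Phi' r = Phi r, so it is linear in r, so it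
vanishes for r > 0 when u and w are bounded; and Phi' 0 is 2 pi times the
derivative of u at the centre.

On the side of lattices, a Gram matrix interior to the set of reduced ones
satisfies the inequalities of Minkowski strictly, apart from the trivial ones,
because it stays reduced under small perturbations in every direction. If b and
b' are two tame bases of one lattice, one shows by induction on k that
b'_k = +b_k or -b_k: the earlier vectors being the same up to sign, b'_k is
admissible in the condition that makes the norm of b_k minimal, and conversely,
so the minimum is attained at b'_k and strictness applies. Since consecutive
vectors of a tame basis have a positive scalar product, the sign is the same for
all k ([tame_basis_unique]).

Now right multiplication by c <> 0 multiplies Gram matrices by |c|^2, so it
preserves tame bases ([tame_rmul]). A tame basis b of a lattice equivalent to L
yields the representative b (b_0)^-1. Two representatives v and w satisfy w = v c
up to sign, and comparing the first vectors, both equal to 1, gives c = +1 or -1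
with that very sign, hence w = v. *)

Set Implicit Arguments.
Unset Strict Implicit.
Unset Printing Implicit Defensive.

Import Order.TTheory GRing.Theory Num.Theory.
Import numFieldNormedType.Exports.

Local Open Scope classical_set_scope.
Local Open Scope ring_scope.
Local Open Scope quotient_scope.

(** * Quaternion algebra *)

Section QuatAlg.
Context {R : realType}.
Implicit Types (p q r a : quat R) (x y : R).

Lemma ord4_ind (P : 'I_4 -> Prop) : P 0 -> P 1 -> P 2 -> P 3 -> forall i, P i.
Proof.
move=> P0 P1 P2 P3 [[|[|[|[|//]]]] ?].
- by move: P0; congr P; apply/val_inj.
- by move: P1; congr P; apply/val_inj.
- by move: P2; congr P; apply/val_inj.
- by move: P3; congr P; apply/val_inj.
Qed.

Lemma quatP p q : p 0 0 = q 0 0 -> p 0 1 = q 0 1 -> p 0 2 = q 0 2 ->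
  p 0 3 = q 0 3 -> p = q.
Proof. by move=> *; apply/rowP; apply: ord4_ind. Qed.

Lemma sum4E (V : nmodType) (F : 'I_4 -> V) :
  \sum_(i < 4) F i = F 0 + F 1 + F 2 + F 3.
Proof.
rewrite !big_ord_recr big_ord0 /= add0r.
by congr (F _ + F _ + F _ + F _); apply/val_inj.
Qed.

Lemma qmkE (a b c d : R) :
  ((qmk a b c d : quat R) 0 0 = a) * ((qmk a b c d : quat R) 0 1 = b) *
  ((qmk a b c d : quat R) 0 2 = c) * ((qmk a b c d : quat R) 0 3 = d).
Proof. by rewrite !mxE. Qed.

Lemma qdotE p q : qdot p q =
  p 0 0 * q 0 0 + p 0 1 * q 0 1 + p 0 2 * q 0 2 + p 0 3 * q 0 3.
Proof. exact: sum4E. Qed.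

Lemma qmulE p q :
  (qmul p q 0 0 = p 0 0 * q 0 0 - p 0 1 * q 0 1 - p 0 2 * q 0 2 - p 0 3 * q 0 3) *
  (qmul p q 0 1 = p 0 0 * q 0 1 + p 0 1 * q 0 0 + p 0 2 * q 0 3 - p 0 3 * q 0 2) *
  (qmul p q 0 2 = p 0 0 * q 0 2 - p 0 1 * q 0 3 + p 0 2 * q 0 0 + p 0 3 * q 0 1) *
  (qmul p q 0 3 = p 0 0 * q 0 3 + p 0 1 * q 0 2 - p 0 2 * q 0 1 + p 0 3 * q 0 0).
Proof. by rewrite /qmul !qmkE. Qed.

Lemma qoneE : ((qone : quat R) 0 0 = 1) * ((qone : quat R) 0 1 = 0) *
  ((qone : quat R) 0 2 = 0) * ((qone : quat R) 0 3 = 0).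
Proof. by rewrite /qone !qmkE. Qed.

Lemma addmxE p q i : (p + q) 0 i = p 0 i + q 0 i. Proof. by rewrite mxE. Qed.
Lemma oppmxE p i : (- p) 0 i = - p 0 i. Proof. by rewrite mxE. Qed.
Lemma scalemxE x p i : (x *: p) 0 i = x * p 0 i. Proof. by rewrite mxE. Qed.
Lemma mx0E i : (0 : quat R) 0 i = 0. Proof. by rewrite mxE. Qed.

Definition qE := (qmulE, qoneE, qmkE, addmxE, oppmxE, scalemxE, mx0E, qdotE).

Local Ltac quat := apply: quatP; rewrite !qE; ring.

Lemma qmulA p q r : qmul p (qmul q r) = qmul (qmul p q) r.
Proof. by quat. Qed.
Lemma qmulDl p q r : qmul (p + q) r = qmul p r + qmul q r.
Proof. by quat. Qed.
Lemma qmulDr p q r : qmul p (q + r) = qmul p q + qmul p r.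
Proof. by quat. Qed.
Lemma qmulZl x p q : qmul (x *: p) q = x *: qmul p q.
Proof. by quat. Qed.
Lemma qmulZr x p q : qmul p (x *: q) = x *: qmul p q.
Proof. by quat. Qed.
Lemma qmul1 p : qmul p qone = p.
Proof. by quat. Qed.
Lemma q1mul p : qmul qone p = p.
Proof. by quat. Qed.
Lemma qmulNl p q : qmul (- p) q = - qmul p q.
Proof. by quat. Qed.
Lemma qmulNr p q : qmul p (- q) = - qmul p q.
Proof. by quat. Qed.
Lemma qmulBl p q r : qmul (p - q) r = qmul p r - qmul q r.
Proof. by rewrite qmulDl qmulNl. Qed.
Lemma qmul0 p : qmul p 0 = 0.
Proof. by quat. Qed.
Lemma q0mul p : qmul 0 p = 0.
Proof. by quat. Qed.

Lemma qdotC p q : qdot p q = qdot q p.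
Proof. by rewrite /qdot; apply: eq_bigr => i _; rewrite mulrC. Qed.

Lemma qdotBl p q r : qdot (p - q) r = qdot p r - qdot q r.
Proof. rewrite !qE; ring. Qed.
Lemma qdot_mulr p q a : qdot (qmul p a) (qmul q a) = qdot p q * qdot a a.
Proof. rewrite !qE; ring. Qed.
Lemma qdot1 : qdot qone qone = 1 :> R.
Proof. rewrite !qE; ring. Qed.

Lemma qdot_ge0 p : 0 <= qdot p p.
Proof. by apply: sumr_ge0 => i _; rewrite -expr2 sqr_ge0. Qed.

Lemma qdot_eq0 p : (qdot p p == 0) = (p == 0).
Proof.
apply/eqP/eqP => [/eqP|->]; last by rewrite /qdot big1// => i _; rewrite mxE mulr0.
rewrite psumr_eq0 => [/allP H|i _]; last by rewrite -expr2 sqr_ge0.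
apply/rowP => i; rewrite mxE.
by have := H i (mem_index_enum _); rewrite /= -expr2 sqrf_eq0 => /eqP.
Qed.

Definition qconj p : quat R := qmk (p 0 0) (- p 0 1) (- p 0 2) (- p 0 3).
Definition qinv p : quat R := (qdot p p)^-1 *: qconj p.

Lemma qmulV p : p != 0 -> qmul p (qinv p) = qone.
Proof.
rewrite -qdot_eq0 => p0; rewrite qmulZr -[qone](scale1r) -(mulVf p0) -scalerA.
congr (_ *: _); apply: quatP; rewrite /qconj !qE; ring.
Qed.

Lemma qmulVr p : p != 0 -> qmul (qinv p) p = qone.
Proof.
rewrite -qdot_eq0 => p0; rewrite qmulZl -[qone](scale1r) -(mulVf p0) -scalerA.
congr (_ *: _); apply: quatP; rewrite /qconj !qE; ring.
Qed.

Lemma qone_neq0 : qone != 0 :> quat R.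
Proof. by rewrite -qdot_eq0 qdot1 oner_eq0. Qed.

Lemma qinv_neq0 p : p != 0 -> qinv p != 0.
Proof.
move=> p0; apply: contraNneq qone_neq0 => E.
by rewrite -(qmulV p0) E qmul0.
Qed.

Lemma qmul_neq0 p q : p != 0 -> q != 0 -> qmul p q != 0.
Proof.
move=> p0 q0; apply: contraNneq q0 => E.
by rewrite -[q]q1mul -(qmulVr p0) -qmulA E qmul0.
Qed.

Lemma qinvM p q : p != 0 -> q != 0 -> qinv (qmul p q) = qmul (qinv q) (qinv p).
Proof.
move=> p0 q0; have pq0 := qmul_neq0 p0 q0.
rewrite -[RHS]qmul1 -(qmulV pq0) qmulA -(qmulA (qinv q)) (qmulA (qinv p)).
by rewrite qmulVr// q1mul qmulVr// q1mul.
Qed.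

Lemma qinvK p : p != 0 -> qinv (qinv p) = p.
Proof.
by move=> p0; rewrite -[RHS]qmul1 -(qmulV (qinv_neq0 p0)) qmulA qmulV// q1mul.
Qed.

Lemma imag_unitP (I : quat R) : imag_units I <->
  I 0 0 = 0 /\ I 0 1 ^+ 2 + I 0 2 ^+ 2 + I 0 3 ^+ 2 = 1.
Proof.
split => [|[I0 IE]]; last first.
  rewrite /imag_units /=; apply: quatP; rewrite !qE I0; try ring.
  by rewrite -IE; ring.
rewrite /imag_units /= => H.
have E i := congr1 (fun p : quat R => p 0 i) H.
move: (E 0) (E 1) (E 2) (E 3); rewrite !qE => E0 E1 E2 E3.
have I0 : I 0 0 = 0 by nra.
by split => //; move: E0; rewrite I0; nra.
Qed.

Lemma qdot_imag (I p q : quat R) : imag_units I ->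
  qdot (qmul I p) q = - qdot p (qmul I q).
Proof. by move=> /imag_unitP[I0 _]; rewrite !qE I0; ring. Qed.

Lemma qmul_imagK (I p : quat R) : imag_units I -> qmul I (qmul I p) = - p.
Proof. by rewrite /imag_units /= qmulA => ->; rewrite qmulNl q1mul. Qed.

Lemma slice_surj q : exists I z, imag_units I /\ q = slice I z.
Proof.
pose s := q 0 1 ^+ 2 + q 0 2 ^+ 2 + q 0 3 ^+ 2.
have s0 : 0 <= s by rewrite !addr_ge0// sqr_ge0.
have [E|ne] := eqVneq s 0.
  exists (qmk 0 1 0 0), (q 0 0, 0); split.
    by apply/imag_unitP; rewrite !qE; split => //; ring.
  have [E1 E2 E3] : [/\ q 0 1 = 0, q 0 2 = 0 & q 0 3 = 0].
    by rewrite /s in E; split; nra.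
  by apply: quatP; rewrite /slice !qE /= ?E1 ?E2 ?E3; ring.
have sp : 0 < s by rewrite lt0r ne.
have rp : Num.sqrt s != 0 by rewrite gt_eqF// sqrtr_gt0.
exists (qmk 0 (q 0 1 / Num.sqrt s) (q 0 2 / Num.sqrt s) (q 0 3 / Num.sqrt s)).
exists (q 0 0, Num.sqrt s); split.
  apply/imag_unitP; rewrite !qE; split => //.
  by rewrite !expr_div_n sqr_sqrtr// -!mulrDl divff.
by apply: quatP; rewrite /slice !qE /=; field.
Qed.

Lemma sliceD (I : quat R) z z' : slice I (z + z') = slice I z + slice I z'.
Proof. by rewrite /slice /= !scalerDl addrACA. Qed.

Lemma sliceZ (I : quat R) x z : slice I (x *: z) = x *: slice I z.
Proof. by rewrite /slice /= scalerDr !scalerA. Qed.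

Lemma slice0 (I : quat R) : slice I 0 = 0.
Proof. by rewrite /slice /= !scale0r addr0. Qed.

Lemma slice_continuous (I : quat R) : continuous (slice I).
Proof.
move=> z; apply: cvgD; apply: cvgZr_tmp; [exact: cvg_fst|exact: cvg_snd].
Qed.

Lemma quat_decomp q : q = q 0 0 *: qmk 1 0 0 0 + q 0 1 *: qmk 0 1 0 0
  + q 0 2 *: qmk 0 0 1 0 + q 0 3 *: qmk 0 0 0 1.
Proof. by apply: quatP; rewrite !qE; ring. Qed.

Lemma qmul_continuous a : continuous (fun q => qmul q a).
Proof.
have -> : (fun q => qmul q a) = (fun q => q 0 0 *: qmul (qmk 1 0 0 0) a +
    q 0 1 *: qmul (qmk 0 1 0 0) a + q 0 2 *: qmul (qmk 0 0 1 0) a +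
    q 0 3 *: qmul (qmk 0 0 0 1) a).
  by apply/funext => q; rewrite {1}[q]quat_decomp !qmulDl !qmulZl.
have cZ (i : 'I_4) (v : quat R) : continuous (fun q : quat R => q 0 i *: v).
  by move=> q; apply: (@cvgZr_tmp _ _ _ (nbhs q)); exact: coord_continuous.
by move=> q; do 3! [apply: (@cvgD _ _ _ (nbhs q)); last exact: cZ]; exact: cZ.
Qed.

Lemma slice_qmul (I : quat R) z a : qmul (slice I z) a = z.1 *: a + z.2 *: qmul I a.
Proof. by rewrite /slice qmulDl !qmulZl q1mul. Qed.

Lemma coord_norm q i : `|q 0 i| <= `|q|.
Proof.
rewrite [leRHS]/Num.Def.normr /= mx_normrE.
by apply: (le_trans _ (le_bigmax _ _ (0, i))).
Qed.

Lemma ler_norm_quat p q : (forall i, `|p 0 i| <= `|q 0 i|) -> `|p| <= `|q|.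
Proof.
move=> H; rewrite [leLHS]/Num.Def.normr /= mx_normrE.
apply: bigmax_le => // -[i j] _ /=; rewrite [i]ord1.
exact: le_trans (H j) (coord_norm _ _).
Qed.

Lemma norm_qone : `|qone : quat R| <= 1.
Proof.
rewrite [leLHS]/Num.Def.normr /= mx_normrE.
apply: bigmax_le => // -[i j] _ /=; rewrite [i]ord1.
by move: j; apply: ord4_ind; rewrite qoneE ?normr1 ?normr0 ?ler01.
Qed.

Lemma qdot_bound p q : `|qdot p q| <= 4 * `|p| * `|q|.
Proof.
rewrite (le_trans (ler_norm_sum _ _ _))//.
rewrite (@le_trans _ _ (\sum_(i < 4) `|p| * `|q|))//.
  by apply: ler_sum => i _; rewrite normrM ler_pM ?coord_norm.
by rewrite sumr_const card_ord -[leLHS]mulr_natl mulrA.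
Qed.

Lemma qdot_continuous q : continuous (qdot ^~ q).
Proof.
have -> : (qdot ^~ q) = (fun p : quat R =>
    p 0 0 * q 0 0 + p 0 1 * q 0 1 + p 0 2 * q 0 2 + p 0 3 * q 0 3).
  by apply/funext => p; rewrite qdotE.
have cZ (i : 'I_4) : continuous (fun p : quat R => p 0 i * q 0 i).
  move=> p; apply: (@cvgM _ _ (nbhs p)); first exact: coord_continuous.
  exact: cvg_cst.
by move=> p; do 3! [apply: (@cvgD _ _ _ (nbhs p)); last exact: cZ]; exact: cZ.
Qed.

Lemma qmul_suml (F : 'I_4 -> quat R) a : qmul (\sum_i F i) a = \sum_i qmul (F i) a.
Proof. by rewrite !sum4E !qmulDl. Qed.

Lemma qdot_suml (F : 'I_4 -> quat R) (c : 'I_4 -> R) q :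
  qdot (\sum_i c i *: F i) q = \sum_i c i * qdot (F i) q.
Proof. by rewrite !sum4E; rewrite !qE; ring. Qed.
End QuatAlg.

(** * The theorem of Liouville for C^1 solutions of the Cauchy-Riemann equations *)

Section Liouville.
Context {R : realType}.

Lemma is_derive_line (f : R * R -> R) (p v : R * R) (t d : R) :
  is_derive (p + t *: v) v f d ->
  is_derive t (1 : R) (fun s : R => f (p + s *: v)) d.
Proof.
have E : (fun h : R => h^-1 *: (f (h *: v + (p + t *: v)) - f (p + t *: v))) =
  (fun h : R => h^-1 *: (f (p + (h *: 1 + t) *: v) - f (p + t *: v))).
  apply/funext => h; congr (_ *: (f _ - _)).
  by rewrite [h *: 1]mulr1 scalerDl addrCA.
case=> dv De; split; first by move: dv; rewrite /derivable E.
by move: De; rewrite /derive E.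
Qed.

Lemma is_derive_fst (f : R * R -> R) (x y d : R) :
  is_derive (x, y) ((1, 0) : R * R) f d ->
  is_derive x (1 : R) (fun s => f (s, y)) d.
Proof.
have E s : (s, y) = (0, y) + s *: ((1, 0) : R * R).
  apply/pair_equal_spec; split; rewrite /= /GRing.scale /=.
    by rewrite mulr1 add0r.
  by rewrite mulr0 addr0.
rewrite E => /is_derive_line.
by under [in X in X -> _]eq_fun do rewrite -E.
Qed.

Lemma is_derive_snd (f : R * R -> R) (x y d : R) :
  is_derive (x, y) ((0, 1) : R * R) f d ->
  is_derive y (1 : R) (fun s => f (x, s)) d.
Proof.
have E s : (x, s) = (x, 0) + s *: ((0, 1) : R * R).
  apply/pair_equal_spec; split; rewrite /= /GRing.scale /=.
    by rewrite mulr0 addr0.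
  by rewrite mulr1 add0r.
rewrite E => /is_derive_line.
by under [in X in X -> _]eq_fun do rewrite -E.
Qed.

Lemma is_derive_affine (a c t : R) : is_derive t (1 : R) (fun s => a + s * c) c.
Proof.
have H : is_derive t (1 : R) (cst a + id * cst c : R -> R) (0 + (t *: 0 + c *: 1)).
  exact: is_deriveD.
by apply: (is_derive_eq H); rewrite scaler0 !add0r scaler1.
Qed.

Lemma is_derive_affineM (a r t d : R) (g : R -> R) :
  is_derive t (1 : R) g d -> is_derive t (1 : R) (fun s => a + r * g s) (r * d).
Proof.
move=> dg.
have H : is_derive t (1 : R) (cst a + r *: g : R -> R) (0 + r *: d).
  exact: is_deriveD.
by apply: (is_derive_eq H); rewrite add0r.
Qed.

Lemma is_derive_continuous (g dg : R -> R) :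
  (forall t, is_derive t (1 : R) g (dg t)) -> continuous g.
Proof.
by move=> H t; apply/differentiable_continuous/derivable1_diffP; case: (H t).
Qed.

(** The mean value theorem without an order on the end points. *)
Lemma mvt_line (f df : R -> R) (a b : R) :
  (forall t : R, is_derive t (1 : R) f (df t)) ->
  exists c, `|c - a| <= `|b - a| /\ f b - f a = df c * (b - a).
Proof.
move=> dff; have cf := is_derive_continuous dff.
have [ab|ba] := leP a b.
  have [c] := MVT_segment ab (fun t _ => dff t) (continuous_subspaceT cf).
  rewrite in_itv /= => /andP[ac cb] E; exists c; split => //.
  by rewrite !ger0_norm ?subr_ge0// lerD2r.
have [c] := MVT_segment (ltW ba) (fun t _ => dff t) (continuous_subspaceT cf).
rewrite in_itv /= => /andP[bc ca] E; exists c; split.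
  by rewrite !ler0_norm ?subr_le0 ?(ltW ba)// lerN2 lerD2r.
by rewrite -opprB E -mulrN opprB.
Qed.

Section ChainRule.
Variables (u ux uy : R * R -> R).
Hypothesis du1 : forall z, is_derive z ((1, 0) : R * R) u (ux z).
Hypothesis du2 : forall z, is_derive z ((0, 1) : R * R) u (uy z).
Hypothesis cux : continuous ux.
Hypothesis cuy : continuous uy.

(** Continuity of the partial derivatives replaces differentiability of u: the
increment of u along the curve is split into a horizontal and a vertical one,
and the mean value theorem applies to each of them. *)
Lemma chain_rule (al be : R -> R) (t a b : R) :
  is_derive t (1 : R) al a -> is_derive t (1 : R) be b ->
  is_derive t (1 : R) (fun s => u (al s, be s))
    (ux (al t, be t) * a + uy (al t, be t) * b).
Proof.
move=> [dal Eal] [dbe Ebe].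
have cal : {for t, continuous al}.
  exact: differentiable_continuous ((derivable1_diffP _ _).1 dal).
have cbe : {for t, continuous be}.
  exact: differentiable_continuous ((derivable1_diffP _ _).1 dbe).
have mx h : exists c, `|c - al t| <= `|al (h + t) - al t| /\
   u (al (h + t), be (h + t)) - u (al t, be (h + t)) =
   ux (c, be (h + t)) * (al (h + t) - al t).
  have [|c [c1 c2]] := @mvt_line (fun s => u (s, be (h + t)))
    (fun s => ux (s, be (h + t))) (al t) (al (h + t)); last by exists c.
  by move=> s; exact: is_derive_fst.
have my h : exists c, `|c - be t| <= `|be (h + t) - be t| /\
   u (al t, be (h + t)) - u (al t, be t) = uy (al t, c) * (be (h + t) - be t).
  have [|c [c1 c2]] := @mvt_line (fun s => u (al t, s))
    (fun s => uy (al t, s)) (be t) (be (h + t)); last by exists c.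
  by move=> s; exact: is_derive_snd.
have [xi Hxi] := choice mx; have [eta Heta] := choice my.
have shc (g : R -> R) : {for t, continuous g} -> g (h + t) @[h --> 0^'] --> g t.
  move=> cg; apply: (@cvg_comp _ _ _ (fun h => h + t) g _ (nbhs t)) => //.
  have: h + t @[h --> (0:R)] --> 0 + t by apply: cvgD; [exact: cvg_id|exact: cvg_cst].
  by rewrite add0r; apply: cvg_trans; apply: cvg_app; exact: nbhs_dnbhs.
(* the intermediate points converge by squeezing *)
have sq (g c : R -> R) : {for t, continuous g} ->
    (forall h, `|c h - g t| <= `|g (h + t) - g t|) -> c h @[h --> 0^'] --> g t.
  move=> cg H; apply/cvgrPdist_le => e e0.
  have /cvgrPdist_le /(_ _ e0) := shc g cg.
  apply: filterS => h; rewrite distrC [`|g t - c h|]distrC.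
  exact: le_trans (H h).
have q (g : R -> R) d : derivable g t 1 -> 'D_1 g t = d ->
    h^-1 * (g (h + t) - g t) @[h --> 0^'] --> d.
  move=> dg <-; have : (fun h => h^-1 *: (g (h *: 1 + t) - g t)) @ 0^' --> 'D_1 g t.
    exact: dg.
  by under eq_fun do rewrite [_ *: 1]mulr1.
have L : h^-1 *: (u (al (h *: 1 + t), be (h *: 1 + t)) - u (al t, be t)) @[h --> 0^']
    --> ux (al t, be t) * a + uy (al t, be t) * b.
  have -> : (fun h : R =>
      h^-1 *: (u (al (h *: 1 + t), be (h *: 1 + t)) - u (al t, be t))) =
      (fun h => ux (xi h, be (h + t)) * (h^-1 * (al (h + t) - al t)) +
                uy (al t, eta h) * (h^-1 * (be (h + t) - be t))).
    apply/funext => h; rewrite [h *: 1]mulr1 -[_ *: _]/(_ * _).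
    rewrite -(subrKA (u (al t, be (h + t)))) (Hxi h).2 (Heta h).2 mulrDr.
    by congr (_ + _); exact: mulrCA.
  apply: cvgD; apply: cvgM.
  - apply: (@cvg_comp _ _ _ (fun h => (xi h, be (h + t))) ux _ (nbhs (al t, be t)));
      last exact: cux.
    apply: (@cvg_pair _ _ _ (0^') (nbhs (al t)) (nbhs (be t))); last exact: shc.
    by apply: sq => // h; exact: (Hxi h).1.
  - exact: q dal Eal.
  - apply: (@cvg_comp _ _ _ (fun h => (al t, eta h)) uy _ (nbhs (al t, be t)));
      last exact: cuy.
    apply: (@cvg_pair _ _ _ (0^') (nbhs (al t)) (nbhs (be t))).
      exact: cvg_cst.
    by apply: sq => // h; exact: (Heta h).1.
  - exact: q dbe Ebe.
by split; [apply/cvg_ex; eexists; exact: L|exact/cvg_lim].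
Qed.

End ChainRule.

Section CauchyRiemann.
Variables (u w ux wx : R * R -> R).
Hypothesis du1 : forall z, is_derive z ((1, 0) : R * R) u (ux z).
Hypothesis du2 : forall z, is_derive z ((0, 1) : R * R) u (- wx z).
Hypothesis dw1 : forall z, is_derive z ((1, 0) : R * R) w (wx z).
Hypothesis dw2 : forall z, is_derive z ((0, 1) : R * R) w (ux z).
Hypothesis cux : continuous ux.
Hypothesis cwx : continuous wx.

Section Circle.
Variables x0 y0 : R.

(* P r parametrizes the circle of radius r about (x0, y0), and f r is the real
   part of e^(-i t) (u + i w) on it *)
Let P (r t : R) : R * R := (x0 + r * cos t, y0 + r * sin t).
Let f (r t : R) : R := u (P r t) * cos t + w (P r t) * sin t.

Let cuy : continuous (fun z => - wx z).
Proof. by move=> z; apply: cvgN; exact: cwx. Qed.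

(* the real part of e^(-i t) times the radial derivative e^(i t) (u + i w)' *)
Let dradial r t : is_derive r (1 : R) (f^~ t) (ux (P r t)).
Proof.
have dal := is_derive_affine x0 (cos t) r.
have dbe := is_derive_affine y0 (sin t) r.
have dU := chain_rule du1 du2 cux cuy dal dbe.
have dW := chain_rule dw1 dw2 cwx cux dal dbe.
have H := is_deriveD (is_deriveM dU (is_derive_cst (cos t) r 1))
                     (is_deriveM dW (is_derive_cst (sin t) r 1)).
apply: (is_derive_eq H); rewrite -/(P r t) /GRing.scale /=.
have /esym E := cos2Dsin2 t.
rewrite -[RHS]mulr1 E; ring.
Qed.

Let dcirc r t : is_derive t (1 : R) (fun t => w (P r t) * cos t - u (P r t) * sin t)
  (r * ux (P r t) - f r t).
Proof.
have dal := is_derive_affineM x0 r (is_derive_cos t).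
have dbe := is_derive_affineM y0 r (is_derive_sin t).
have dU := chain_rule du1 du2 cux cuy dal dbe.
have dW := chain_rule dw1 dw2 cwx cux dal dbe.
have H := is_deriveB (is_deriveM dW (is_derive_cos t))
                     (is_deriveM dU (is_derive_sin t)).
apply: (is_derive_eq H); rewrite -/(P r t) /GRing.scale /= /f.
have /esym E := cos2Dsin2 t.
rewrite -[X in _ = r * X - _]mulr1 E; ring.
Qed.

Let cP r : continuous (P r).
Proof.
move=> t; apply: (@cvg_pair _ _ _ (nbhs t) (nbhs _) (nbhs _)); apply: cvgD.
- exact: cvg_cst.
- by apply: cvgM; [exact: cvg_cst|exact: continuous_cos].
- exact: cvg_cst.
- by apply: cvgM; [exact: cvg_cst|exact: continuous_sin].
Qed.

Let cuxP r : continuous (fun t => ux (P r t)).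
Proof. by move=> t; apply: continuous_comp; [exact: cP|exact: cux]. Qed.

Let cuu r : continuous (fun t => u (P r t)).
Proof.
apply: is_derive_continuous => t.
exact: (chain_rule du1 du2 cux cuy (is_derive_affineM x0 r (is_derive_cos t))
  (is_derive_affineM y0 r (is_derive_sin t))).
Qed.

Let cww r : continuous (fun t => w (P r t)).
Proof.
apply: is_derive_continuous => t.
exact: (chain_rule dw1 dw2 cwx cux (is_derive_affineM x0 r (is_derive_cos t))
  (is_derive_affineM y0 r (is_derive_sin t))).
Qed.

Let cf r : continuous (f r).
Proof.
move=> t; apply: cvgD; apply: cvgM.
- exact: cuu.
- exact: continuous_cos.
- exact: cww.
- exact: continuous_sin.
Qed.

Let mu := @lebesgue_measure R.
Let B : set R := `[0, 2 * pi].
Let Phi (r : R) : R := (\int[mu]_(t in B) f r t)%R.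

Let mB : measurable (B : set (measurableTypeR R)).
Proof. exact: measurable_itv. Qed.

Let intB (g : R -> R) : continuous g -> mu.-integrable B (EFin \o g).
Proof.
move=> cg; apply: continuous_compact_integrable; first exact: segment_compact.
exact: continuous_subspaceT.
Qed.

Let ux_bound (r : R) : exists M, forall s t, `|s| <= r -> `|ux (P s t)| <= M.
Proof.
have [r0|r0] := ltP r 0.
  by exists 0 => s t; move=> /le_lt_trans /(_ r0); rewrite normr_lt0.
pose K : set (R * R) := `[x0 - r, x0 + r] `*` `[y0 - r, y0 + r].
have cK : compact K by apply: compact_setX; exact: segment_compact.
have cn : continuous (fun z => `|ux z|).
  by move=> z; apply: cvg_norm; exact: cux.
have K0 : K !=set0.
  by exists (x0, y0); split; rewrite /= in_itv /= lerDl lerBlDr lerDl r0.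
have [c _ Hc] := compact_EVT_max K0 cK (continuous_subspaceT cn).
have bd (s g : R) : `|s| <= r -> `|g| <= 1 -> `|s * g| <= r.
  by move=> sr g1; rewrite normrM -[r]mulr1 ler_pM.
exists `|ux c| => s t sr; apply: Hc; rewrite inE; split; rewrite /= in_itv /=.
  have := bd _ _ sr (cos_max t); rewrite ler_norml => /andP[? ?].
  by apply/andP; split; lra.
have := bd _ _ sr (sin_max t); rewrite ler_norml => /andP[? ?].
by apply/andP; split; lra.
Qed.

Let dPhi r : is_derive r (1 : R) Phi (\int[mu]_(t in B) ux (P r t))%R.
Proof.
have [M HM] := ux_bound (`|r| + 1).
have M0 : 0 <= M by apply: le_trans (HM 0 0 _); rewrite ?normr_ge0// normr0 addr_ge0.
have d1E s t : partial1of2 f s t = ux (P s t).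
  by rewrite partial1of2E; case: (dradial s t).
have Ir : `]r - 1, r + 1[%classic r by rewrite /= in_itv /= ltrDl ltrBlDr ltrDl ltr01.
have bd s : `]r - 1, r + 1[%classic s -> `|s| <= `|r| + 1.
  rewrite /= in_itv /= => /andP[s1 s2].
  rewrite -[s](subrK r) addrC (le_trans (ler_normD _ _))// lerD2l ler_norml.
  by apply/andP; split; lra.
have H := @cvg_differentiation_under_integral R _ _ mu f B _ r (r - 1) (r + 1) Ir
  (fun s _ => intB (@cf s)) _ (cst M) (fun _ => M0) (intB (@cst_continuous _ _ M)).
have {}H : h^-1 *: (Phi (h + r) - Phi r) @[h --> 0^'] -->
    (\int[mu]_(t in B) ux (P r t))%R.
  have -> : (\int[mu]_(t in B) ux (P r t) = \int[mu]_(t in B) partial1of2 f r t)%R.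
    by apply: eq_Rintegral => t _; rewrite d1E.
  apply: H => [|s t _ _|s t Is _]; first exact: mB.
    by case: (dradial s t).
  by rewrite d1E; exact/HM/bd.
have E : (fun h : R => h^-1 *: (Phi (h *: 1 + r) - Phi r)) =
  (fun h : R => h^-1 *: (Phi (h + r) - Phi r)).
  by apply/funext => h; rewrite [h *: 1]mulr1.
split; first by apply/cvg_ex; eexists; rewrite E; exact: H.
by rewrite /derive E; exact/cvg_lim.
Qed.

(* the difference of both sides is the integral of the derivative in t of the
   imaginary part w cos - u sin, which is periodic *)
Let euler r : r * (\int[mu]_(t in B) ux (P r t))%R = Phi r.
Proof.
have tpi : 0 < 2 * pi :> R by rewrite mulr_gt0// pi_gt0.
have I1 : mu.-integrable B (EFin \o (fun t => r * ux (P r t))).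
  by apply: intB => t; apply: cvgM; [exact: cvg_cst|exact: cuxP].
apply/eqP; rewrite -subr_eq0 -(RintegralZl _ mB (intB (@cuxP r))).
rewrite -(RintegralB mB I1 (intB (@cf r))).
have cd : continuous (fun t => r * ux (P r t) - f r t).
  move=> t; apply: cvgB; last exact: cf.
  by apply: cvgM; [exact: cvg_cst|exact: cuxP].
have cF := is_derive_continuous (dcirc r).
have dF t : derivable (fun t => w (P r t) * cos t - u (P r t) * sin t) t 1.
  by case: (dcirc r t).
pose G t := w (P r t) * cos t - u (P r t) * sin t.
rewrite /Rintegral (@continuous_FTC2 _ _ G _ _ tpi) /=.
- by rewrite /G /P mulr_natl cos2pi sin2pi cos0 sin0 subrr.
- exact: continuous_subspaceT.
- split=> [t _||]; first exact: dF.
    by apply: cvg_at_right_filter; exact: cF.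
  by apply: cvg_at_left_filter; exact: cF.
- by move=> t _; rewrite derive1E; case: (dcirc r t).
Qed.

(** By [euler], Phi r / r is constant for r > 0, so the boundedness of Phi makes
Phi vanish there; its derivative at 0 is then 0, but it is also 2 pi times the
value of ux at the centre. *)
Lemma bounded_CR_dx0 (C : R) :
  (forall z, `|u z| <= C) -> (forall z, `|w z| <= C) -> ux (x0, y0) = 0.
Proof.
move=> bu bw.
have tpi : 0 < 2 * pi :> R by rewrite mulr_gt0// pi_gt0.
have muB : fine (mu B) = 2 * pi.
  by rewrite /mu /B lebesgue_measure_itv /= lte_fin tpi -EFinB subr0.
have C0 : 0 <= C by apply: le_trans (bu (0, 0)).
have fb r t : `|f r t| <= C + C.
  rewrite (le_trans (ler_normD _ _))// !normrM lerD// -[C]mulr1 ler_pM//.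
    exact: cos_max.
  exact: sin_max.
have Phib r : `|Phi r| <= (C + C) * (2 * pi).
  rewrite (le_trans (le_normr_Rintegral mB (intB (@cf r))))//.
  rewrite -muB -(Rintegral_cst mu mB).
  apply: (le_Rintegral mB) => //.
    by apply: intB => t; apply: cvg_norm; exact: cf.
  by apply: intB => t; exact: cvg_cst.
pose I1 r := (\int[mu]_(t in B) ux (P r t))%R.
have I1E (a b : R) : 0 < a -> a < b -> I1 a = I1 b.
  move=> a0 ab.
  have b0 := lt_trans a0 ab.
  pose g : R -> R := fun r => Phi r * r^-1.
  have dg (r : R) : 0 < r -> is_derive r (1 : R) g 0.
    move=> r0; have r1 : r != 0 by rewrite gt_eqF.
    have H := is_deriveM (dPhi r) (is_deriveV r1 (is_derive_id r (1:R))).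
    apply: (is_derive_eq H); rewrite -euler /GRing.scale /=.
    by field.
  have [||c _] := @MVT _ g (cst 0) a b ab.
  - by move=> r; rewrite in_itv /= => /andP[ar _]; apply: dg; exact: lt_trans ar.
  - apply: derivable_within_continuous => r; rewrite in_itv /= => /andP[ar _].
    by case: (dg r (lt_le_trans a0 ar)).
  rewrite mul0r /g -!euler ![_ * I1 _]mulrC !mulfK ?gt_eqF// => /eqP.
  by rewrite subr_eq0 => /eqP.
have Phi0 (a : R) : 0 < a -> Phi a = 0.
  move=> a0; apply/eqP; case: eqP => // /eqP Pa.
  (* b is so large that |Phi b| = b |I1 a| exceeds the bound *)
  pose b := a + (1 + (C + C) * (2 * pi) / `|I1 a|).
  have I1a : 0 < `|I1 a|.
    by rewrite normr_gt0; apply: contraNneq Pa => E; rewrite -euler -/(I1 a) E mulr0.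
  have ab : a < b by rewrite /b ltrDl ltr_pwDl// divr_ge0// mulr_ge0 ?addr_ge0// ltW.
  have := Phib b; rewrite -euler -/(I1 b) -(I1E _ _ a0 ab) normrM.
  rewrite gtr0_norm ?(lt_trans a0)// leNgt -ltr_pdivrMr// /b; case/negP.
  by rewrite addrA ltrDr addr_gt0.
have Phi00 : Phi 0 = 0 by rewrite -euler mul0r.
have [D1 D2] := dPhi 0.
have : \int[mu]_(t in B) ux (P 0 t) = 0.
  rewrite -D2.
  have H : h^-1 *: (Phi (h *: 1 + 0) - Phi 0) @[h --> 0^'+] --> 'D_1 Phi 0.
    exact: (cvg_dnbhs_at_right D1).
  have H0 : h^-1 *: (Phi (h *: 1 + 0) - Phi 0) @[h --> 0^'+] --> (0 : R).
    apply: (cvg_near_cst).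
    near=> h.
    have h0 : 0 < h by near: h; exact: nbhs_right_gt.
    by rewrite [h *: 1]mulr1 addr0 Phi00 Phi0// subrr scaler0.
  exact: cvg_unique H H0.
have -> : (\int[mu]_(t in B) ux (P 0 t) = \int[mu]_(t in B) (cst (ux (x0, y0)) t))%R.
  by apply: eq_Rintegral => t _; rewrite /P !mul0r !addr0.
rewrite (Rintegral_cst mu mB) muB => /eqP.
by rewrite mulf_eq0 (gt_eqF tpi) orbF => /eqP.
Unshelve. all: by end_near. Qed.
End Circle.

Theorem liouville_CR (C : R) :
  (forall z, `|u z| <= C) -> (forall z, `|w z| <= C) -> forall z, ux z = 0.
Proof. by move=> bu bw [x y]; exact: bounded_CR_dx0 bu bw. Qed.
End CauchyRiemann.
End Liouville.

(** * Slice regularity at a point and the theorem of Liouville on a slice *)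

Section SliceLiouville.
Context {R : realType}.
Implicit Types (I v : quat R) (z s : R * R).

(** The pointwise condition in [slice_regular], for a function on the parameter
plane of a slice. *)
Definition regular_at I (f : R * R -> quat R) z :=
  [/\ derivable f z (1, 0) /\ derivable f z (0, 1),
      {for z, continuous ('D_((1, 0) : R * R) f)} /\
      {for z, continuous ('D_((0, 1) : R * R) f)} &
      2^-1 *: ('D_((1, 0) : R * R) f z + qmul I ('D_((0, 1) : R * R) f z)) = 0].

Lemma regular_at_CR I f z : imag_units I -> regular_at I f z ->
  'D_((0, 1) : R * R) f z = qmul I ('D_((1, 0) : R * R) f z).
Proof.
move=> hI [_ _] /eqP; rewrite scaler_eq0 invr_eq0 pnatr_eq0 /= addr_eq0 => /eqP ->.
by rewrite qmulNr qmul_imagK// opprK.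
Qed.

Lemma regular_at_near I f g z : (\near z, f z = g z) ->
  regular_at I f z -> regular_at I g z.
Proof.
move=> fg [[d1 d2] [c1 c2] E].
have nD w : \near z, 'D_w f z = 'D_w g z.
  have := nbhs_interior fg; apply: filterS => y; exact: near_eq_derive.
have D w : 'D_w f z = 'D_w g z by exact: nbhs_singleton (nD w).
have cD w : {for z, continuous ('D_w f)} -> {for z, continuous ('D_w g)}.
  move=> c; rewrite /prop_for /continuous_at -D.
  exact: cvg_trans (near_eq_cvg (nD w)) c.
split.
- by split; apply: near_eq_derivable fg _.
- by split; [exact: (cD _ c1)|exact: (cD _ c2)].
- by rewrite -!D.
Qed.

Lemma regular_at_shift I f z s :
  regular_at I f (z + s) -> regular_at I (fun y => f (y + s)) z.
Proof.
have E (w y : R * R) (h : R) : h^-1 *: (f (h *: w + y + s) - f (y + s)) =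
    h^-1 *: (f (h *: w + (y + s)) - f (y + s)) by rewrite addrA.
have D w y : 'D_w (fun y => f (y + s)) y = 'D_w f (y + s).
  by rewrite /derive; under eq_fun do rewrite E.
have d w : derivable f (z + s) w -> derivable (fun y => f (y + s)) z w.
  by rewrite /derivable; under [in X in _ -> X]eq_fun do rewrite E.
have cD w : {for z + s, continuous ('D_w f)} ->
    {for z, continuous ('D_w (fun y => f (y + s)))}.
  move=> c; rewrite (_ : 'D_w _ = fun y => 'D_w f (y + s)); last exact/funext.
  have cs : {for z, continuous (fun y : R * R => y + s)}.
    by apply: cvgD; [exact: cvg_id|exact: cvg_cst].
  exact: (continuous_comp cs c).
move=> [[d1 d2] [c1 c2] e]; split.
- by split; [exact: (d _ d1)|exact: (d _ d2)].
- by split; [exact: (cD _ c1)|exact: (cD _ c2)].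
- by rewrite (D ((1, 0) : R * R)) (D ((0, 1) : R * R)).
Qed.

Lemma regular_atD I (f : R * R -> quat R) (c : quat R) z :
  regular_at I f z -> regular_at I (fun y => c + f y) z.
Proof.
set g : R * R -> quat R := fun y => c + f y.
have E (w y : R * R) (h : R) : h^-1 *: (g (h *: w + y) - g y) =
    h^-1 *: (f (h *: w + y) - f y) by rewrite /g opprD addrACA subrr add0r.
have D w y : 'D_w g y = 'D_w f y.
  by rewrite /derive; under eq_fun do rewrite E.
have d w : derivable f z w -> derivable g z w.
  by rewrite /derivable; under [in X in _ -> X]eq_fun do rewrite E.
clearbody g; move=> [[d1 d2] [c1 c2] e]; split.
- by split; [exact: (d _ d1)|exact: (d _ d2)].
- have Df w : 'D_w g = 'D_w f by apply/funext => y; exact: D.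
  by split; rewrite Df; [exact: c1|exact: c2].
- by rewrite D D; exact: e.
Qed.

(** Regularity is assumed near z, since continuity at z of the partial
derivatives of f - g involves derivability at the nearby points. *)
Lemma regular_atB I (f g : R * R -> quat R) z :
  (\forall y \near z, regular_at I f y) -> (\forall y \near z, regular_at I g y) ->
  regular_at I (f - g) z.
Proof.
move=> nf ng.
have [[f1 f2] [cf1 cf2] ef] := nbhs_singleton nf.
have [[g1 g2] [cg1 cg2] eg] := nbhs_singleton ng.
have D1 : \forall y \near z,
    'D_((1, 0) : R * R) f y - 'D_((1, 0) : R * R) g y = 'D_((1, 0) : R * R) (f - g) y.
  apply: filterS2 nf ng => y [[fy _] _ _] [[gy _] _ _].
  exact: esym (deriveB fy gy).
have D2 : \forall y \near z,
    'D_((0, 1) : R * R) f y - 'D_((0, 1) : R * R) g y = 'D_((0, 1) : R * R) (f - g) y.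
  apply: filterS2 nf ng => y [[_ fy] _ _] [[_ gy] _ _].
  exact: esym (deriveB fy gy).
have cD w : {for z, continuous ('D_w f)} -> {for z, continuous ('D_w g)} ->
    (\forall y \near z, 'D_w f y - 'D_w g y = 'D_w (f - g) y) ->
    {for z, continuous ('D_w (f - g))}.
  move=> c1 c2 n; rewrite /prop_for /continuous_at -(nbhs_singleton n).
  apply: cvg_trans (near_eq_cvg n) _.
  exact: (cvgB c1 c2).
split.
- by split; [exact: derivableB f1 g1|exact: derivableB f2 g2].
- by split; [exact: (cD _ cf1 cg1 D1)|exact: (cD _ cf2 cg2 D2)].
have alg (p q p' q' : quat R) : 2^-1 *: (p + qmul I q) = 0 ->
    2^-1 *: (p' + qmul I q') = 0 -> 2^-1 *: (p - p' + qmul I (q - q')) = 0.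
  move=> E E'; rewrite qmulDr qmulNr addrACA -opprD scalerBr E E'.
  exact: subr0.
rewrite -(nbhs_singleton D1) -(nbhs_singleton D2).
exact: alg ef eg.
Qed.

Lemma is_derive_qdot (f : R * R -> quat R) (w z : R * R) d v :
  is_derive z w f d -> is_derive z w (fun y => qdot (f y) v) (qdot d v).
Proof.
move=> [df E].
have H (i : 'I_4) : is_derive z w (fun y => f y 0 i) (d 0 i).
  split; first by move/derivable_mxP : df.
  by rewrite -E derive_mx// mxE.
have HM (i : 'I_4) : is_derive z w ((fun y => f y 0 i) * cst (v 0 i)) (d 0 i * v 0 i).
  have := is_deriveM (H i) (is_derive_cst (v 0 i) z w).
  by move/is_derive_eq; apply; rewrite scaler0 add0r [LHS]mulrC.
have := is_derive_sum (fun i => HM i).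
congr (is_derive _ _ _ _); apply/funext => y; rewrite fct_sumE /qdot.
by apply: eq_bigr.
Qed.

(** The scalar functions u = <h, v> and w = <h, I v> satisfy the Cauchy-Riemann
equations for every v, because left multiplication by I is skew-symmetric with
square -1. *)
Lemma slice_liouville I (h : R * R -> quat R) (C : R) :
  imag_units I -> (forall z, regular_at I h z) -> (forall z, `|h z| <= C) ->
  forall z, h z = h 0.
Proof.
move=> hI reg bd.
pose hx := 'D_((1, 0) : R * R) h.
have dh1 z : is_derive z ((1, 0) : R * R) h (hx z).
  have [[h1 _] _ _] := reg z; exact: DeriveDef h1 erefl.
have dh2 z : is_derive z ((0, 1) : R * R) h (qmul I (hx z)).
  have [[_ h2] _ _] := reg z.
  exact: DeriveDef h2 (regular_at_CR hI (reg z)).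
have chx : continuous hx by move=> z; have [_ [c1 _] _] := reg z; exact: c1.
clearbody hx.
have cq v : continuous (fun z => qdot (hx z) v).
  move=> z; exact: (continuous_comp (chx z) (@qdot_continuous _ v (hx z))).
have hx0 z : hx z = 0.
  apply/eqP; rewrite -qdot_eq0; apply/eqP; set v := {2}(hx z).
  pose K := 4 * C * (`|v| + `|qmul I v|).
  have bK y v' : `|v'| <= `|v| + `|qmul I v| -> `|qdot (h y) v'| <= K.
    move=> v'K; apply: (le_trans (qdot_bound _ _)).
    by apply: ler_pM => //; rewrite ?mulr_ge0// ler_pM2l.
  apply: (@liouville_CR _ (fun y => qdot (h y) v) (fun y => qdot (h y) (qmul I v))
    (fun y => qdot (hx y) v) (fun y => qdot (hx y) (qmul I v)) _ _ _ _ _ _ K) => y.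
  - exact: is_derive_qdot.
  - by rewrite -qdot_imag//; exact: is_derive_qdot.
  - exact: is_derive_qdot.
  - have := is_derive_qdot (qmul I v) (dh2 y).
    move/is_derive_eq; apply; rewrite qdot_imag// qmul_imagK//.
    by rewrite !qE; ring.
  - exact: cq.
  - exact: cq.
  - by apply: bK; rewrite lerDl.
  - by apply: bK; rewrite lerDr.
move=> [x y]; apply/eqP; rewrite -subr_eq0 -qdot_eq0; set v := h (x, y) - h 0.
have : qdot (h (x, y)) v - qdot (h 0) v = 0.
  have q0 : qdot 0 v = 0 by rewrite !qE; ring.
  have [|c [_ H1]] := @mvt_line _ (fun t => qdot (h (t, y)) v) (cst 0) 0 x.
    move=> t; have := is_derive_qdot v (dh1 (t, y)); rewrite hx0 q0.
    exact: (@is_derive_fst _ (fun z => qdot (h z) v)).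
  have [|c' [_ H2]] := @mvt_line _ (fun t => qdot (h (0, t)) v) (cst 0) 0 y.
    move=> t; have := is_derive_qdot v (dh2 (0, t)); rewrite hx0 qmul0 q0.
    exact: (@is_derive_snd _ (fun z => qdot (h z) v)).
  by rewrite -(subrKA (qdot (h (0, y)) v)) H1 H2 !mul0r addr0.
by move=> H; rewrite {1}/v qdotBl H.
Qed.

End SliceLiouville.

(** * Lattices and the projection onto a torus *)

Section TorusBasics.
Context {R : realType}.
Implicit Types (L M : zmodClosed (quat R)) (q x y : quat R).

Lemma torus_projP L x y : torus_proj L x = torus_proj L y <-> x - y \in L.
Proof.
rewrite (Quotient.idealrBE L x y); split => [H|/eqP//].
by apply/eqP.
Qed.

Lemma torus_proj_surj L (t : torus L) : exists x, torus_proj L x = t.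
Proof. by exists (repr t); rewrite /torus_proj reprK. Qed.

Lemma torus_proj_continuous L : continuous (torus_proj L).
Proof. exact: pi_continuous. Qed.

Lemma torus_proj_open L (U : set (quat R)) :
  open U -> open [set torus_proj L x | x in U].
Proof.
move=> oU; rewrite /open /= /quotient_open.
rewrite (_ : _ @^-1` _ = \bigcup_(l in [set l | l \in L]) [set x | U (x + l)]).
  apply: bigcup_open => l _.
  apply: (@open_comp _ _ (fun x => x + l) U) => // x _.
  by apply: (@cvgD _ _ _ (nbhs x)); [exact: cvg_id|exact: cvg_cst].
apply/seteqP; split => [x [y Uy /torus_projP H]|x [l /= Ll Uxl]].
  by exists (y - x) => //=; rewrite addrC subrK.
exists (x + l) => //; apply/torus_projP.
by rewrite addrAC subrr add0r.
Qed.

Definition discrete_in L e := forall x, x \in L -> `|x| < e -> x = 0.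

Lemma zspanP (b : 4.-tuple (quat R)) x : x \in zspan b <->
  exists n : 'rV[int]_4, x = \sum_(i < 4) (n 0 i)%:~R *: tnth b i.
Proof.
rewrite unfold_in; split => [/asboolP[n ->]|[n ->]].
  exists (\row_i n i); apply: eq_bigr => i _.
  by rewrite mxE scaler_int (tnth_nth 0).
apply/asboolP; exists [ffun i => n 0 i]; apply: eq_bigr => i _.
by rewrite ffunE scaler_int (tnth_nth 0).
Qed.

Lemma free_coord_sum (b : 4.-tuple (quat R)) : free b ->
  forall x, x = \sum_(i < 4) coord b i x *: tnth b i.
Proof.
move=> fb x; have bb : basis_of fullv b.
  by rewrite basisEfree fb subvf dimvf /= /dim /= mul1n size_tuple.
rewrite {1}(coord_basis bb (memvf x)); apply: eq_bigr => i _.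
by rewrite (tnth_nth 0).
Qed.

Lemma free_sum_inj (b : 4.-tuple (quat R)) (c d : 'I_4 -> R) : free b ->
  \sum_(i < 4) c i *: tnth b i = \sum_(i < 4) d i *: tnth b i -> c =1 d.
Proof.
move=> fb; under eq_bigr do rewrite (tnth_nth 0).
under [in X in _ = X]eq_bigr do rewrite (tnth_nth 0).
move=> E i; have := coord_sum_free c i fb; rewrite E => <-.
exact: coord_sum_free.
Qed.

(** The coordinates of x in a basis are bounded by a multiple K of the norm of x,
and those of a lattice element are integers. *)
Lemma lattice_discrete L : rank4_lattice L -> exists2 e, 0 < e & discrete_in L e.
Proof.
move=> [b [fb Lb]].
pose K := 1 + \sum_(i < 4) \sum_(j < 4) `|coord b i (delta_mx 0 j)|.
have K0 : 0 < K by rewrite ltr_pwDl// sumr_ge0// => i _; apply: sumr_ge0.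
have Kb x i : `|coord b i x| <= K * `|x|.
  rewrite {1}[x]row_sum_delta linear_sum (le_trans (ler_norm_sum _ _ _))//.
  rewrite (@le_trans _ _ (\sum_(j < 4) `|coord b i (delta_mx 0 j)| * `|x|))//.
    apply: ler_sum => j _; rewrite linearZ /= normrM mulrC ler_wpM2l//.
    exact: coord_norm.
  rewrite -mulr_suml ler_wpM2r// /K [X in _ <= 1 + X](bigD1 i)//= addrCA lerDl.
  by rewrite addr_ge0// sumr_ge0// => k _; apply: sumr_ge0.
exists K^-1; first by rewrite invr_gt0.
move=> x; rewrite Lb => /zspanP[n xE] xK.
rewrite xE big1// => i _.
have ci : coord b i x = (n 0 i)%:~R.
  apply: (@free_sum_inj b (fun i => coord b i x) (fun i => (n 0 i)%:~R) fb _ i).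
  by rewrite -xE -free_coord_sum.
have : `|(n 0 i)%:~R : R| < 1.
  rewrite -ci (le_lt_trans (Kb _ _))//.
  by rewrite -ltr_pdivlMl// mulr1.
rewrite -intr_norm -[1]/(1%:~R) ltr_int => n0.
have -> : n 0 i = 0 by move: n0; lia.
by rewrite scale0r.
Qed.

Lemma lattice_cocompact L : rank4_lattice L ->
  exists2 C, 0 <= C & forall x, exists2 l, l \in L & `|x - l| <= C.
Proof.
move=> [b [fb Lb]].
exists (\sum_(i < 4) `|tnth b i|); first by apply: sumr_ge0.
move=> x; exists (\sum_(i < 4) (Num.floor (coord b i x))%:~R *: tnth b i).
  rewrite Lb; apply/zspanP; exists (\row_i Num.floor (coord b i x)).
  by apply: eq_bigr => i _; rewrite mxE.
rewrite {1}[x](free_coord_sum fb) -sumrB (le_trans (ler_norm_sum _ _ _))//.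
apply: ler_sum => i _; rewrite -scalerBl normrZ ler_piMl// ler_norml.
have := floor_itv (coord b i x); rewrite intrD => /andP[? ?].
by apply/andP; split; lra.
Qed.

(** A ball is a union of segments issued from its centre. *)
Lemma ball_connected (x : quat R) e : connected (ball x e).
Proof.
have -> : ball x e = \bigcup_(y in ball x e) [set x + t *: (y - x) | t in `[0, 1]].
  apply/seteqP; split => [y By|z [y By [t + <-]]].
    exists y => //; exists 1; first by rewrite /= in_itv /= ler01 lexx.
    by rewrite scale1r addrC subrK.
  rewrite /= in_itv /= => /andP[t0 t1].
  move: By; rewrite -!ball_normE /ball_ /= opprD addrA subrr sub0r normrN normrZ.
  rewrite distrC; apply: le_lt_trans.
  by rewrite ler_piMl// ger0_norm.
have [e0|e0] := ltP 0 e; last first.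
  rewrite bigcup0; first exact: connected0.
  move=> y; rewrite -ball_normE /ball_ /= => /(le_lt_trans (normr_ge0 _)).
  by move=> /lt_le_trans/(_ e0); rewrite ltxx.
apply: bigcup_connected.
  exists x => y By; exists 0; first by rewrite /= in_itv /= ler01 lexx.
  by rewrite scale0r addr0.
move=> y _; apply: connected_continuous_connected; first exact: segment_connected.
apply: continuous_subspaceT => t.
apply: (@cvgD _ _ _ (nbhs t)); first exact: cvg_cst.
by apply: (@cvgZr_tmp _ _ _ (nbhs t)); exact: cvg_id.
Qed.

End TorusBasics.

(** * Regular maps between tori are affine *)

Section Lift.
Context {R : realType}.
Variables (L M : zmodClosed (quat R)).
Hypotheses (hL : rank4_lattice L) (hM : rank4_lattice M).
Variable F : torus L -> torus M.
Hypothesis rF : regular_map F.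

Let g (q : quat R) : torus M := F (torus_proj L q).

Let g_continuous : continuous g.
Proof.
move=> q; apply: continuous_comp; first exact: torus_proj_continuous.
exact: rF.1.
Qed.

Let g_per q l : l \in L -> g (q - l) = g q.
Proof.
move=> Ll; congr F; apply/torus_projP.
by rewrite addrAC subrr add0r rpredN.
Qed.

Definition is_increment q q' (d : quat R) :=
  exists2 y, g q = torus_proj M y & g q' = torus_proj M (y + d).

Lemma is_incrementE q q' d y : is_increment q q' d -> g q = torus_proj M y ->
  g q' = torus_proj M (y + d).
Proof.
move=> [y' -> ->] /torus_projP H; apply/torus_projP.
by rewrite opprD addrACA subrr addr0.
Qed.

Lemma compact_closed_ball0 (C : R) : compact [set x : quat R | `|x| <= C].
Proof.
apply: bounded_closed_compact.
  by exists C; split; [exact: num_real|move=> y Cy x /= /le_trans; apply; exact: ltW].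
rewrite (_ : [set _ | _] = (fun x : quat R => `|x|) @^-1` [set y | y <= C])//.
by apply: closed_comp; [move=> x _; exact: norm_continuous|exact: closed_le].
Qed.

(** Around each point this is the continuity of g together with the openness of
the projection; a uniform radius exists by compactness of a ball that meets every
class of L. *)
Lemma uniform_increment e : 0 < e -> exists2 de, 0 < de &
  forall q q', `|q' - q| < de -> exists2 d, `|d| < e & is_increment q q' d.
Proof.
move=> e0; have [C C0 HC] := lattice_cocompact hL.
pose P (de : R) (q : quat R) :=
  forall q', `|q' - q| < de -> exists2 d, `|d| < e & is_increment q q' d.
have loc (q0 : quat R) : exists2 r, 0 < r &
    forall q q', `|q - q0| < r -> `|q' - q0| < r ->
    exists2 d, `|d| < e & is_increment q q' d.
  have [y0 y0E] := torus_proj_surj (g q0).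
  have oV := @torus_proj_open _ M _ (ball_open y0 (e / 2)).
  have : nbhs q0 (g @^-1` [set torus_proj M x | x in ball y0 (e / 2)]).
    apply: g_continuous; apply: open_nbhs_nbhs; split => //.
    by rewrite -y0E; exists y0 => //; apply: ballxx; rewrite divr_gt0.
  rewrite -nbhs_ballE => -[r /= r0 Hr].
  exists r => // q q' qr q'r.
  have [y1 By1 E1] : (g @^-1` [set torus_proj M x | x in ball y0 (e / 2)]) q.
    by apply: Hr; rewrite -ball_normE /ball_ /= distrC.
  have [y2 By2 E2] : (g @^-1` [set torus_proj M x | x in ball y0 (e / 2)]) q'.
    by apply: Hr; rewrite -ball_normE /ball_ /= distrC.
  exists (y2 - y1); last by exists y1; rewrite // addrC subrK.
  move: By1 By2; rewrite -!ball_normE /ball_ /= => B1 B2.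
  rewrite -(subrKA y0) (le_lt_trans (ler_normD _ _))// (splitr e) ltrD//.
  by rewrite distrC.
have /compact_near_coveringP/(_ R (0^'+) P _) := @compact_closed_ball0 C.
case.
  move=> q0 _; have [r r0 Hr] := loc q0.
  exists (ball q0 (r / 2), [set de | de < r / 2]) => /=.
    split; first by apply: nbhsx_ballx; rewrite divr_gt0.
    by apply: nbhs_right_lt; rewrite divr_gt0.
  move=> [q de] /= [Bq der] q' q'q.
  move: Bq; rewrite -ball_normE /ball_ /= distrC => Bq.
  apply: Hr; first by apply: lt_trans Bq _; rewrite ltr_pdivrMr// ltr_pMr// ltr1n.
  rewrite -(subrKA q) (le_lt_trans (ler_normD _ _))// (splitr r) ltrD//.
  exact: lt_trans der.
move=> r /= r0 Hr.
exists (r / 2); first by rewrite divr_gt0.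
move=> q q' qq'; have [l Ll ql] := HC q.
have := Hr (r / 2) _ _ (q - l) ql (q' - l).
rewrite (_ : q' - l - (q - l) = q' - q); last first.
  by rewrite opprD opprK addrACA addNr addr0.
case => //=.
- by rewrite sub0r normrN gtr0_norm ?divr_gt0// ltr_pdivrMr// ltr_pMr// ltr1n.
- by rewrite divr_gt0.
move=> d dle [y E1 E2]; exists d; first exact: dle.
exists y; first exact: etrans (esym (g_per q Ll)) E1.
exact: etrans (esym (g_per q' Ll)) E2.
Qed.

Variables (e de : R).
Hypotheses (e0 : 0 < e) (de0 : 0 < de).
(* a signed sum of four increments has norm less than 4 e; two points of a ball of
   radius de are at distance less than 2 de *)
Hypothesis Me : discrete_in M (4 * e).
Hypothesis Lde : discrete_in L (2 * de).
Hypothesis deP : forall q q', `|q' - q| < de ->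
  exists2 d, `|d| < e & is_increment q q' d.

Definition increment q q' : quat R :=
  xget 0 [set d | `|d| < e /\ is_increment q q' d].

Lemma incrementP q q' : `|q' - q| < de ->
  `|increment q q'| < e /\ is_increment q q' (increment q q').
Proof.
move=> /deP[d d1 d2]; rewrite /increment; case: xgetP => [x _ //|].
by move=> /(_ d) [].
Qed.

Lemma is_increment_inj q q' d d' : is_increment q q' d -> is_increment q q' d' ->
  `|d - d'| < 4 * e -> d = d'.
Proof.
move=> [y E1 E2] /is_incrementE /(_ E1); rewrite E2 => /torus_projP.
rewrite opprD addrACA subrr add0r => Md dd'.
by apply/eqP; rewrite -subr_eq0; apply/eqP/Me.
Qed.

Lemma is_incrementD q q' q'' d d' : is_increment q q' d -> is_increment q' q'' d' ->
  is_increment q q'' (d + d').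
Proof.
move=> [y E1 E2] H; exists y => //; rewrite addrA.
exact: is_incrementE H E2.
Qed.

(** Both sides lead from q to q', so they differ by an element of M, which is 0
because it is small. *)
Lemma increment_cocycle q q1 q2 q' :
  `|q1 - q| < de -> `|q' - q1| < de -> `|q2 - q| < de -> `|q' - q2| < de ->
  increment q q1 + increment q1 q' = increment q q2 + increment q2 q'.
Proof.
move=> /incrementP[a1 b1] /incrementP[a2 b2] /incrementP[a3 b3] /incrementP[a4 b4].
apply: (is_increment_inj (is_incrementD b1 b2) (is_incrementD b3 b4)).
rewrite (le_lt_trans (ler_normB _ _))//.
rewrite (le_lt_trans (lerD (ler_normD _ _) (ler_normD _ _)))//.
by rewrite (_ : 4 * e = (e + e) + (e + e)) ?ltrD//; ring.
Qed.

Lemma increment_refl q : increment q q = 0.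
Proof.
have /incrementP[a b] : `|q - q| < de by rewrite subrr normr0.
apply: (is_increment_inj b).
  by have [y yE] := torus_proj_surj (g q); exists y; rewrite ?addr0.
by rewrite subr0 (lt_trans a)// ltr_pMl// ltr1n.
Qed.

(** On the ball U about q, the map y + increment q is the expression of F in the
charts whose images are U and the ball V about a representative y of the value of
F at the class of q. *)
Lemma increment_regular I q z : imag_units I -> `|slice I z - q| < de ->
  regular_at I (fun z => increment q (slice I z)) z.
Proof.
move=> hI zq.
have [y yE] := torus_proj_surj (g q).
pose U := ball q de; pose V := ball y e.
pose phi (t : torus L) : quat R := xget 0 [set x | U x /\ torus_proj L x = t].
pose psi (t : torus M) : quat R := xget 0 [set x | V x /\ torus_proj M x = t].
have cU : @torus_chart _ L U phi.
  split; [exact: ball_open|exact: ball_connected|move=> x /set_mem Ux].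
  rewrite /phi; case: xgetP => [x' _ [Ux' E]|/(_ x) []//].
  move/torus_projP: E => /Lde E; apply/eqP; rewrite -subr_eq0; apply/eqP/E.
  move: Ux Ux'; rewrite /U -!ball_normE /ball_ /= => Ux Ux'.
  rewrite -(subrKA q) (le_lt_trans (ler_normD _ _))// mulr_natl mulr2n ltrD//.
  by rewrite distrC.
have cV : @torus_chart _ M V psi.
  split; [exact: ball_open|exact: ball_connected|move=> x /set_mem Ux].
  rewrite /psi; case: xgetP => [x' _ [Ux' E]|/(_ x) []//].
  move/torus_projP: E => /Me E; apply/eqP; rewrite -subr_eq0; apply/eqP/E.
  move: Ux Ux'; rewrite /V -!ball_normE /ball_ /= => Ux Ux'.
  rewrite -(subrKA y) (le_lt_trans (ler_normD _ _))//.
  have -> : 4 * e = (e + e) + (e + e) by ring.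
  rewrite (@lt_trans _ _ (e + e))// ?ltrDl ?addr_gt0// ltrD//.
  by rewrite distrC.
have gE x : `|x - q| < de ->
    V (y + increment q x) /\ g x = torus_proj M (y + increment q x).
  move=> /incrementP[a b]; split; last exact: is_incrementE b (esym yE).
  by rewrite /V -ball_normE /ball_ /= opprD addrA subrr sub0r normrN.
have psiE x : `|x - q| < de -> psi (g x) = y + increment q x.
  move=> /gE[a ->]; have [_ _] := cV; apply; exact: mem_set.
have Uz : U (slice I z) by rewrite /U -ball_normE /ball_ /= distrC.
have := rF.2 _ _ _ _ cU cV I hI z.
case.
  split => //=; have [a b] := gE _ zq.
  by exists (y + increment q (slice I z)).
move=> A1 A2 A3.
have reg : regular_at I (fun z => psi (g (slice I z))) z by split.
have reg' : regular_at I (fun z => - y + psi (g (slice I z))) z by exact: regular_atD.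
apply: regular_at_near reg'.
have nU0 : nbhs (slice I z) U.
  by apply: open_nbhs_nbhs; split => //; exact: ball_open.
have nU : \forall x \near z, U (slice I x) by exact: (@slice_continuous _ I z _ nU0).
apply: filterS nU => x.
rewrite /U -ball_normE /ball_ /= distrC => xq.
by rewrite psiE// addrA addNr add0r.
Qed.

(** Near a point x of the slice, the increment from y to y + s equals, by the
cocycle relation, the difference of two local lifts of F up to a constant. Thus
it is regular on the whole slice; being bounded, it is constant. *)
Lemma increment_translate I z s : imag_units I -> `|slice I s| < de ->
  increment (slice I z) (slice I (z + s)) = increment 0 (slice I s).
Proof.
move=> hI sde.
pose h z := increment (slice I z) (slice I (z + s)).
have ds x : `|slice I (x + s) - slice I x| < de.
  by rewrite sliceD addrAC subrr add0r.
have hreg x : regular_at I h x.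
  pose f1 y := increment (slice I (x + s)) (slice I (y + s)).
  pose f2 y := increment (slice I x) (slice I y).
  have n1 : \forall y \near x, `|slice I y - slice I x| < de.
    have nU : \forall y \near x, ball (slice I x) de (slice I y).
      exact: (@slice_continuous _ I x _ (nbhsx_ballx (slice I x) de de0)).
    by apply: filterS nU => y; rewrite -ball_normE /ball_ /= distrC.
  have n2 y : slice I (y + s) - slice I (x + s) = slice I y - slice I x.
    by rewrite !sliceD opprD addrACA subrr addr0.
  have r1 : \forall y \near x, regular_at I f1 y.
    apply: filterS n1 => y yx.
    apply: (@regular_at_shift _ I (fun y => increment (slice I (x + s)) (slice I y))).
    by apply: increment_regular; rewrite ?n2.
  have r2 : \forall y \near x, regular_at I f2 y.
    by apply: filterS n1 => y yx; apply: increment_regular.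
  have := regular_atD (increment (slice I x) (slice I (x + s))) (regular_atB r1 r2).
  apply: regular_at_near.
  apply: filterS n1 => y yx; rewrite /h /f1 /f2.
  have H := increment_cocycle yx (ds y) (ds x) _.
  have {}H := H _; rewrite -[LHS]/(_ + (_ - _)) addrA -H ?n2//.
  by rewrite addrAC subrr add0r.
have := @slice_liouville _ I h e hI hreg _ z.
rewrite /h slice0 add0r; apply => x.
by apply/ltW; have [] := incrementP (ds x).
Qed.

Lemma increment_additive I s s' : imag_units I -> `|slice I s| < de ->
  `|slice I s'| < de -> `|slice I (s + s')| < de ->
  increment 0 (slice I (s + s')) = increment 0 (slice I s) + increment 0 (slice I s').
Proof.
move=> hI d1 d2 d3.
rewrite -(increment_translate s hI d2).
have := @increment_cocycle 0 (slice I s) 0 (slice I (s + s')).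
rewrite subr0 subrr normr0 subr0 increment_refl add0r => -> //.
by rewrite sliceD addrAC subrr add0r.
Qed.

(** An additive function that is derivable along w at 0 is linear along w: its
difference quotients at the points x 2^-n w are all equal. *)
Lemma increment_linear I (w : R * R) (x : R) :
  imag_units I -> `|slice I (x *: w)| < de ->
  derivable (fun z => increment 0 (slice I z)) 0 w ->
  increment 0 (slice I (x *: w)) = x *: 'D_w (fun z => increment 0 (slice I z)) 0.
Proof.
move=> hI xw dw.
pose f (z : R * R) := increment 0 (slice I z).
pose t n : R := x * 2^-1 ^+ n.
have tn n : `|slice I (t n *: w)| < de.
  rewrite /t -scalerA scalerA [x * _]mulrC -scalerA sliceZ.
  rewrite normrZ (le_lt_trans _ xw)//.
  by rewrite ler_piMl// normrX ger0_norm ?exprn_ile1 ?invr_ge0// invf_le1// ler1n.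
have H n : f (x *: w) = 2 ^+ n *: f (t n *: w).
  elim: n => [|n ->]; first by rewrite /t expr0 mulr1 scale1r.
  have E : t n *: w = t n.+1 *: w + t n.+1 *: w.
    by rewrite -scalerDl /t exprS; congr (_ *: _); field.
  rewrite {1}/f E increment_additive//; last by rewrite -E.
  by rewrite exprSr -scalerA scaler_nat mulr2n.
have [->|x0] := eqVneq x 0.
  by rewrite !scale0r slice0 increment_refl.
have t0 n : t n != 0 by rewrite mulf_neq0// expf_neq0// invr_eq0.
have f0 : f 0 = 0 by rewrite /f slice0 increment_refl.
have lim1 : (t n)^-1 *: (f (t n *: w + 0) - f 0) @[n --> \oo] --> 'D_w f 0.
  have tc : t n @[n --> \oo] --> 0^'.
    have T0 : t n @[n --> \oo] --> (0 : R).
      rewrite -(mulr0 x); apply: cvgM; first exact: cvg_cst.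
      by apply: cvg_expr; rewrite ger0_norm ?invr_ge0// invf_lt1// ltr1n.
    move=> A HA; have H1 : \forall n \near \oo, t n != 0 -> A (t n) := T0 _ HA.
    have : \forall n \near \oo, A (t n) by apply: filterS H1 => n; apply; exact: t0.
    exact.
  have dw' : (fun h : R => h^-1 *: (f (h *: w + 0) - f 0)) @ 0^' --> 'D_w f 0.
    exact: dw.
  exact: (@cvg_comp _ _ _ t (fun h : R => h^-1 *: (f (h *: w + 0) - f 0)) _ _ _ tc dw').
have lim2 : (t n)^-1 *: (f (t n *: w + 0) - f 0) @[n --> \oo] --> x^-1 *: f (x *: w).
  apply: cvg_near_cst; apply: nearW => n.
  by rewrite addr0 f0 subr0 (H n) scalerA /t invfM exprVn invrK.
have E : 'D_w f 0 = x^-1 *: f (x *: w) by apply: cvg_unique lim1 lim2.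
transitivity (x *: (x^-1 *: f (x *: w))); last by congr (_ *: _); exact: esym E.
by rewrite scalerA divff// scale1r.
Qed.

(** The coefficient a is determined by the values at real points, which belong to
every slice. *)
Lemma increment_affine : exists a, forall q, `|q| < de -> increment 0 q = qmul q a.
Proof.
pose r := de / 2.
have r0 : 0 < r by rewrite divr_gt0.
exists (r^-1 *: increment 0 (r *: qone)) => q qde.
have [I [z [hI qz]]] := slice_surj q; rewrite qz in qde *.
have S1 x : slice I (x *: ((1, 0) : R * R)) = x *: qone.
  by rewrite sliceZ /slice /= scale1r scale0r addr0.
have S2 y : slice I (y *: ((0, 1) : R * R)) = y *: I.
  by rewrite sliceZ /slice /= scale1r scale0r add0r.
have reg : regular_at I (fun z => increment 0 (slice I z)) 0.
  by apply: increment_regular; rewrite // slice0 subr0 normr0.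
have [[d1 d2] _ _] := reg.
have CR := regular_at_CR hI reg.
pose D := 'D_((1, 0) : R * R) (fun z => increment 0 (slice I z)) 0.
have lin1 x : `|slice I (x *: ((1, 0) : R * R))| < de ->
    increment 0 (slice I (x *: ((1, 0) : R * R))) = x *: D.
  by move=> xde; exact: increment_linear hI xde d1.
have lin2 y : `|slice I (y *: ((0, 1) : R * R))| < de ->
    increment 0 (slice I (y *: ((0, 1) : R * R))) = y *: qmul I D.
  move=> yde.
  exact: etrans (increment_linear hI yde d2) (congr1 (fun v => y *: v) CR).
clear d1 d2 CR reg; clearbody D.
have -> : increment 0 (r *: qone) = r *: D.
  rewrite -(S1 r); apply: lin1; rewrite S1 normrZ.
  rewrite gtr0_norm// (@le_lt_trans _ _ (r * 1))//.
    by rewrite ler_pM2l//; exact: norm_qone.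
  by rewrite mulr1 /r ltr_pdivrMr// ltr_pMr// ltr1n.
rewrite scalerA mulVf ?gt_eqF// scale1r.
have [I0 _] := (imag_unitP I).1 hI.
have zE : z = z.1 *: ((1, 0) : R * R) + z.2 *: ((0, 1) : R * R).
  rewrite [LHS]surjective_pairing; apply/pair_equal_spec.
  by split; rewrite /= /GRing.scale /= mulr1 mulr0 ?addr0 ?add0r.
have n1 : `|slice I (z.1 *: ((1, 0) : R * R))| < de.
  apply: le_lt_trans qde; rewrite S1; apply: ler_norm_quat.
  by apply: ord4_ind; rewrite /slice !qE ?I0 ?mulr0 ?mulr1 ?normr0 ?addr0.
have n2 : `|slice I (z.2 *: ((0, 1) : R * R))| < de.
  apply: le_lt_trans qde; rewrite S2; apply: ler_norm_quat.
  by apply: ord4_ind; rewrite /slice !qE ?I0 ?mulr0 ?normr0 ?add0r.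
rewrite slice_qmul {1}zE increment_additive//; last by rewrite -zE.
by rewrite lin1// lin2.
Qed.

(** The segment from 0 to q is cut into n pieces shorter than de, all contained
in one slice. *)
Lemma lift_affine : exists a b, forall q, g q = torus_proj M (qmul q a + b).
Proof.
have [a Ha] := increment_affine.
have [b bE] := torus_proj_surj (g 0).
exists a, b => q.
have [I [z [hI qz]]] := slice_surj q.
pose n := (Num.truncn (`|q| / de)).+1.
have n0 : (0 : R) < n%:R by rewrite ltr0n.
pose s := n%:R^-1 *: z.
have sde : `|slice I s| < de.
  rewrite /s sliceZ -qz normrZ gtr0_norm ?invr_gt0// ltr_pdivrMl//.
  by rewrite mulrC -ltr_pdivrMl// mulrC /n truncnS_gt.
have H k : g (slice I (k%:R *: s)) = torus_proj M (qmul (slice I (k%:R *: s)) a + b).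
  elim: k => [|k IH]; first by rewrite scale0r slice0 q0mul add0r bE.
  rewrite -natr1 scalerDl scale1r.
  have [_ A] : `|increment (slice I (k%:R *: s)) (slice I (k%:R *: s + s))| < e /\
     is_increment (slice I (k%:R *: s)) (slice I (k%:R *: s + s))
       (increment (slice I (k%:R *: s)) (slice I (k%:R *: s + s))).
    by apply: incrementP; rewrite sliceD addrAC subrr add0r.
  rewrite (is_incrementE A IH) increment_translate// Ha// [in RHS]sliceD qmulDl.
  by rewrite addrAC.
have := H n; rewrite /s scalerA divff ?gt_eqF// scale1r -qz; exact.
Qed.
End Lift.

Theorem regular_torus_map_affine (R : realType) (L M : zmodClosed (quat R))
    (F : torus L -> torus M) : rank4_lattice L -> rank4_lattice M -> regular_map F ->
  exists a b, forall q, F (torus_proj L q) = torus_proj M (qmul q a + b).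
Proof.
move=> hL hM rF.
have [eM eM0 HM] := lattice_discrete hM.
have [eL eL0 HL] := lattice_discrete hL.
have e0 : 0 < eM / 4 by rewrite divr_gt0.
have [de de0 Hde] := uniform_increment hL rF e0.
pose d := Num.min de (eL / 2).
have d0 : 0 < d by rewrite /d lt_min de0 divr_gt0.
apply: (@lift_affine _ L M F rF (eM / 4) d e0 d0).
- by move=> x Mx xe; apply: HM => //; move: xe; rewrite mulrC divfK.
- move=> x Lx xd; apply: HL => //; apply: lt_le_trans xd _.
  by rewrite mulrC -ler_pdivlMr// /d ge_min lexx orbT.
- by move=> q q' qq'; apply: Hde; apply: lt_le_trans qq' _; rewrite /d ge_min lexx.
Qed.

(** * Equivalence of tori *)

Section Homothety.
Context {R : realType}.
Implicit Types (L M : zmodClosed (quat R)) (a : quat R).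

Lemma is_derive_slice_affine (I a m : quat R) (y w : R * R) :
  is_derive y w (fun z => m + qmul (slice I z) a) (qmul (slice I w) a).
Proof.
pose quotient h : quat R :=
  h^-1 *: ((m + qmul (slice I (h *: w + y)) a) - (m + qmul (slice I y) a)).
have E : \forall h \near (0:R)^', quotient h = qmul (slice I w) a.
  near=> h; rewrite /quotient.
  rewrite opprD addrACA subrr add0r sliceD qmulDl addrK sliceZ qmulZl.
  rewrite scalerA mulVf ?scale1r//.
  by near: h; exact: nbhs_dnbhs_neq.
have C : quotient h @[h --> (0:R)^'] --> qmul (slice I w) a by exact: cvg_near_cst.
by split; [apply/cvg_ex; eexists; exact: C|exact/cvg_lim].
Unshelve. all: by end_near. Qed.

Lemma regular_at_affine (I a m : quat R) z : imag_units I ->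
  regular_at I (fun z => m + qmul (slice I z) a) z.
Proof.
move=> hI; pose f z := m + qmul (slice I z) a.
have d y w := is_derive_slice_affine I a m y w.
have D w y : 'D_w f y = qmul (slice I w) a by case: (d y w).
have Df w : 'D_w f = cst (qmul (slice I w) a) by apply/funext => y; exact: D.
split.
- by split; [case: (d z ((1, 0) : R * R))|case: (d z ((0, 1) : R * R))].
- by split; rewrite Df; exact: cvg_cst.
- rewrite [X in _ *: (X + _)]D [X in qmul I X]D !slice_qmul /=.
  by rewrite !scale1r !scale0r addr0 add0r qmul_imagK// subrr scaler0.
Qed.

Definition homothety L M a (t : torus L) : torus M := torus_proj M (qmul (repr t) a).

Lemma homothetyE L M a : (forall l, l \in L -> qmul l a \in M) ->
  forall q, @homothety L M a (torus_proj L q) = torus_proj M (qmul q a).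
Proof.
move=> H q; apply/torus_projP; rewrite -qmulBl; apply: H.
by apply/torus_projP; rewrite /torus_proj reprK.
Qed.

(** In charts a homothety is locally q |-> q a + m with m in M. *)
Lemma homothety_regular L M a : (forall l, l \in L -> qmul l a \in M) ->
  regular_map (@homothety L M a).
Proof.
move=> H; split.
  apply/quotient_continuous.
  have -> : @homothety L M a \o \pi_(torus L) = torus_proj M \o (fun q => qmul q a).
    by apply/funext => q; exact: homothetyE.
  move=> q; apply: continuous_comp; first exact: qmul_continuous.
  exact: torus_proj_continuous.
move=> U phi V psi [oU _ _] [oV _ psiK] I hI /= z [Uz [y Vy yE]].
move: yE; rewrite (homothetyE H) => yE.
pose m := y - qmul (slice I z) a.
have Mm : m \in M by apply/torus_projP.
suff reg : regular_at I (fun z => psi (@homothety L M a (torus_proj L (slice I z)))) z.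
  by case: reg.
apply: regular_at_near (regular_at_affine a m z hI).
have cf : {for z, continuous (fun z => m + qmul (slice I z) a)}.
  apply: (@cvgD _ _ _ (nbhs z)); first exact: cvg_cst.
  have ca := @qmul_continuous _ a (slice I z).
  exact: (continuous_comp (@slice_continuous _ I z) ca).
have nV : nbhs (m + qmul (slice I z) a) V.
  by apply: open_nbhs_nbhs; split => //; rewrite /m subrK.
have nV' : \forall x \near z, V (m + qmul (slice I x) a) by exact: cf _ nV.
apply: filterS nV' => x Vx.
rewrite homothetyE// -(psiK _ (mem_set Vx)); congr psi.
by apply/torus_projP; rewrite addrK.
Qed.

(** Both a biregular F and its inverse G are affine, with coefficients a and c.
Composing them, q - q a c lies in L for all q, up to a constant in L; as L is
discrete and q arbitrary, a c = 1. The inclusions express that F and G are well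
defined on classes. *)
Lemma equivalent_toriP L M : rank4_lattice L -> rank4_lattice M ->
  equivalent_tori L M <-> exists a, [/\ a != 0,
    forall l, l \in L -> qmul l a \in M & forall m, m \in M -> qmul m (qinv a) \in L].
Proof.
move=> hL hM; split; last first.
  move=> [a [a0 LM ML]]; exists (@homothety L M a), (@homothety M L (qinv a)).
  split; [move=> t|move=> t|exact: homothety_regular|exact: homothety_regular].
    have [q <-] := torus_proj_surj t.
    by rewrite homothetyE// homothetyE// -qmulA qmulV// qmul1.
  have [q <-] := torus_proj_surj t.
  by rewrite homothetyE// homothetyE// -qmulA qmulVr// qmul1.
move=> [F [G [FK GK rF rG]]].
have [a [b Fab]] := regular_torus_map_affine hL hM rF.
have [c [d Gcd]] := regular_torus_map_affine hM hL rG.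
have [e e0 Le] := lattice_discrete hL.
have H q : q - (qmul (qmul q a + b) c + d) \in L.
  by apply/torus_projP; rewrite -Gcd -Fab FK.
have H' q : q - qmul q (qmul a c) \in L.
  have := rpredB (H q) (H 0).
  have E (x u w : quat R) : x - (u + w) + w = x - u by rewrite opprD addrA subrK.
  by rewrite q0mul !add0r opprK qmulDl qmulA -(addrA (qmul (qmul q a) c)) E.
pose v := qone - qmul a c.
have tv (t : R) : t *: v \in L.
  by have := H' (t *: qone); rewrite qmulZl q1mul -scalerBr.
have v0 : v = 0.
  (* t is chosen so that |t v| < e *)
  pose t := e / (2 * (`|v| + 1)).
  have v1 : 0 < `|v| + 1 by rewrite ltr_wpDl.
  have t0 : 0 < t by rewrite divr_gt0// mulr_gt0.
  have : t *: v = 0.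
    apply: Le => //; rewrite normrZ gtr0_norm// /t mulrAC ltr_pdivrMr ?mulr_gt0//.
    rewrite ltr_pM2l// mulrDr mulr1 ltr_pwDr// ler_peMl// ler1n//.
  by move/eqP; rewrite scaler_eq0 (gt_eqF t0) => /eqP.
have ac : qmul a c = qone by apply/esym/eqP; rewrite -subr_eq0 -/v v0.
have a0 : a != 0 by apply: contraNneq (@qone_neq0 R) => az; rewrite -ac az q0mul.
have cE : c = qinv a by rewrite -[c]q1mul -(qmulVr a0) -qmulA ac qmul1.
exists a; split => //.
- move=> l Ll.
  have : torus_proj M (qmul l a + b) = torus_proj M (qmul 0 a + b).
    by rewrite -!Fab; congr F; apply/torus_projP; rewrite subr0.
  by move/torus_projP; rewrite q0mul add0r addrK.
- move=> m Mm; rewrite -cE.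
  have : torus_proj L (qmul m c + d) = torus_proj L (qmul 0 c + d).
    by rewrite -!Gcd; congr G; apply/torus_projP; rewrite subr0.
  by move/torus_projP; rewrite q0mul add0r addrK.
Qed.
End Homothety.

(** * Tame bases *)

Section Minkowski.
Context {R : realType}.
Implicit Types (b : 4.-tuple (quat R)) (A E : 'M[R]_4) (n : 'rV[int]_4).

Definition zcomb b n : quat R := \sum_(i < 4) (n 0 i)%:~R *: tnth b i.
Definition zform A n : R := (map_mx intr n *m A *m (map_mx intr n)^T) 0 0.

Lemma zformE A n : zform A n =
  \sum_(j < 4) \sum_(i < 4) (n 0 i)%:~R * A i j * (n 0 j)%:~R.
Proof.
rewrite /zform mxE; apply: eq_bigr => j _; rewrite !mxE mulr_suml.
by apply: eq_bigr => i _; rewrite !mxE.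
Qed.

Lemma subZmxE A E t (k l : 'I_4) : (A - t *: E) k l = A k l - t * E k l.
Proof. by rewrite !mxE. Qed.

Lemma zformBZ A E t n : zform (A - t *: E) n = zform A n - t * zform E n.
Proof. by rewrite /zform mulmxBr mulmxBl -scalemxAr -scalemxAl !mxE. Qed.

Lemma zformZ A t n : zform (t *: A) n = t * zform A n.
Proof. by rewrite /zform -scalemxAr -scalemxAl mxE. Qed.

Lemma zform_delta (j : 'I_4) n : zform (delta_mx j j) n = (n 0 j)%:~R ^+ 2.
Proof.
rewrite zformE (bigD1 j)//= [X in _ + X]big1 ?addr0 => [|k kj]; last first.
  by rewrite big1// => i _; rewrite mxE (negbTE kj) andbF mulr0 mul0r.
rewrite (bigD1 j)//= big1 ?addr0 => [|k kj]; last first.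
  by rewrite mxE (negbTE kj) mulr0 mul0r.
by rewrite mxE !eqxx mulr1 expr2.
Qed.

Lemma zform_gram b n : zform (gram b) n = qdot (zcomb b n) (zcomb b n).
Proof.
rewrite zformE /zcomb qdot_suml.
under [RHS]eq_bigr do rewrite qdotC qdot_suml mulr_sumr.
rewrite exchange_big /=; apply: eq_bigr => i _; apply: eq_bigr => j _.
by rewrite mxE [qdot (tnth b j) _]qdotC; ring.
Qed.

Lemma gram_sym b : symmetric_mx (gram b).
Proof. by apply/matrixP => i j; rewrite !mxE qdotC. Qed.

Lemma tame_near b : tame_basis b ->
  \forall B \near gram b, B^T = B -> @reduced_gram R B.
Proof.
move=> [_ H].
have : within symmetric_mx (nbhs (gram b)) (@reduced_gram R).
  by rewrite (nbhs_subspace_in (gram_sym b)); exact: H.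
exact.
Qed.

(** Interior points are taken in the space of symmetric matrices, so E has to be
symmetric. *)
Lemma tame_perturb b E : tame_basis b -> E^T = E ->
  exists2 t, 0 < t & minkowski_reduced (gram b - t *: E).
Proof.
move=> tb sE.
have nb := tame_near tb.
have cf : {for (0:R), continuous (fun t : R => gram b - t *: E)}.
  apply: (@cvgB _ _ _ (nbhs (0 : R))); first exact: cvg_cst.
  by apply: (@cvgZr_tmp _ _ _ (nbhs (0 : R))); exact: cvg_id.
have nb0 : nbhs (gram b - 0 *: E) [set B | B^T = B -> @reduced_gram R B].
  by rewrite scale0r subr0.
have := cf _ nb0; rewrite /= -nbhs_ballE => -[e /= e0 He].
exists (e / 2); first by rewrite divr_gt0.
have /He : ball (0:R) e (e / 2).
  rewrite -ball_normE /ball_ /= sub0r normrN gtr0_norm ?divr_gt0//.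
  by rewrite ltr_pdivrMr// ltr_pMr// ltr1n.
rewrite /=; case.
  by rewrite linearB /= linearZ /= sE; congr (_ - _); exact: gram_sym.
by move=> b' [[_ rb'] ->].
Qed.

(** Condition B1 still holds after decreasing the entry (k, l). *)
Lemma tame_offdiag_gt0 b (k l : 'I_4) :
  tame_basis b -> l = k.+1 :> nat -> 0 < gram b k l.
Proof.
move=> tb lk.
have [|t t0 [H _]] := @tame_perturb b (delta_mx k l + delta_mx l k) tb.
  by rewrite linearD /= !trmx_delta addrC.
have kl : (k == l) = false by apply/eqP => kl; move: lk; rewrite kl; lia.
have Ekl : (delta_mx k l + delta_mx l k : 'M[R]_4) k l = 1.
  by rewrite !mxE !eqxx kl /= addr0.
have := H k l lk; rewrite subZmxE Ekl mulr1 subr_ge0.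
exact: lt_le_trans.
Qed.

(** The condition on n in B2. *)
Definition primitive_from (k : 'I_4) n :=
  \big[gcdn/0%N]_(i < 4 | (k <= i)%N) absz (n 0 i) = 1%N.

(** If n had a nonzero entry j <> k, decreasing the diagonal entry (j, j) would
decrease the form at n without changing the entry (k, k), against B2. *)
Lemma tame_minimum b (k : 'I_4) n : tame_basis b -> primitive_from k n ->
  zform (gram b) n = gram b k k ->
  (forall j, j != k -> n 0 j = 0) /\ absz (n 0 k) = 1%N.
Proof.
move=> tb pn eqn.
have n0 j : j != k -> n 0 j = 0.
  move=> jk; apply/eqP/negP => /negP nj.
  have [|t t0 [_ H]] := @tame_perturb b (delta_mx j j) tb.
    by rewrite trmx_delta.
  have := H k n pn; rewrite -/(zform _ n).
  have dk : delta_mx j j k k = 0 :> R by rewrite mxE eq_sym (negbTE jk).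
  rewrite zformBZ zform_delta subZmxE dk mulr0 subr0 eqn.
  rewrite lerBrDr gerDl.
  apply/negP; rewrite -ltNge mulr_gt0// lt0r sqr_ge0 andbT sqrf_eq0 intr_eq0//.
split => //.
move: pn; rewrite /primitive_from (bigD1 k)//= big1 ?gcdn0// => i /andP[_ ik].
by rewrite n0.
Qed.

(** The sum is a Bezout relation, so a common divisor of the entries of n from k on
divides 1. *)
Lemma primitive_fromP (k : 'I_4) n (w : 'I_4 -> int) :
  \sum_(i < 4 | (k <= i)%N) n 0 i * w i = 1 -> primitive_from k n.
Proof.
move=> H; rewrite /primitive_from; set d := \big[_/_]_(i < 4 | _) _.
have : (d%:Z %| (1 : int)%R)%Z.
  rewrite -H; apply: rpred_sum => i ki; apply: dvdz_mulr.
  by rewrite dvdzE /= /d; apply: (biggcdn_inf i).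
by rewrite dvdzE /= dvdn1 => /eqP.
Qed.

Lemma zcomb_inj b m n : free b -> zcomb b m = zcomb b n -> m = n.
Proof.
move=> fb E; apply/rowP => i.
have := @free_sum_inj _ b (fun i => (m 0 i)%:~R) (fun i => (n 0 i)%:~R) fb E i.
by move/eqP; rewrite eqr_int => /eqP.
Qed.

Section TwoBases.
Variables (b b' : 4.-tuple (quat R)) (U W : 'M[int]_4).
Hypothesis UE : forall k, tnth b' k = zcomb b (row k U).
Hypothesis WE : forall k, tnth b k = zcomb b' (row k W).

Lemma base_change_inv : free b' -> U *m W = 1%:M.
Proof.
move=> fb'; apply/row_matrixP => k; apply: (zcomb_inj fb').
transitivity (tnth b' k).
  rewrite UE /zcomb.
  under [RHS]eq_bigr do rewrite WE /zcomb scaler_sumr.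
  rewrite exchange_big /=; apply: eq_bigr => j _.
  rewrite !mxE rmorph_sum /= scaler_suml; apply: eq_bigr => i _.
  by rewrite !mxE rmorphM /= scalerA.
rewrite /zcomb (bigD1 k)//= big1 ?addr0 => [|i ik]; rewrite !mxE ?eqxx ?scale1r//.
by rewrite eq_sym (negbTE ik) scale0r.
Qed.

Definition signed_upto (k : nat) (V : 'M[int]_4) := forall j : 'I_4, (j < k)%N ->
  (forall i, i != j -> V j i = 0) /\ absz (V j j) = 1%N.

Lemma signed_upto_inv k : U *m W = 1%:M -> signed_upto k U -> signed_upto k W.
Proof.
move=> UW sU j jk; have [U0 U1] := sU j jk.
(* row j of U W is the sign U j j times row j of W *)
have UWj i : U j j * W j i = (j == i)%:R.
  have := congr1 (fun V : 'M[int]_4 => V j i) UW; rewrite [in RHS]mxE => <-.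
  by rewrite mxE (bigD1 j)//= big1 ?addr0 // => l lj; rewrite U0// mul0r.
split=> [i ij|].
  have /eqP := UWj i; rewrite [j == i]eq_sym (negbTE ij) mulf_eq0.
  case/orP => /eqP // E.
  by move: U1; rewrite E.
have /(congr1 absz) := UWj j; rewrite eqxx abszM => /eqP.
by rewrite muln_eq1 => /andP[_ /eqP].
Qed.

(** Rows of W with index below k are signed unit vectors too, so the product of
row k of U with column k of W, which is 1, only involves the indices from k on. *)
Lemma signed_primitive (k : 'I_4) : U *m W = 1%:M -> signed_upto k U ->
  primitive_from k (row k U).
Proof.
move=> UW sU; apply: (@primitive_fromP _ _ (fun i => W i k)).
have := congr1 (fun V : 'M[int]_4 => V k k) UW.
rewrite [in RHS]mxE eqxx mxE (bigID (fun i : 'I_4 => (k <= i)%N))/=.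
rewrite [X in _ + X]big1 ?addr0.
  by move=> E; apply: etrans E; apply: eq_bigr => i _; rewrite mxE.
move=> i; rewrite -ltnNge => ik.
have [W0 _] := signed_upto_inv UW sU ik.
by rewrite W0 ?mulr0//; apply/eqP => E; move: ik; rewrite E ltnn.
Qed.
End TwoBases.

Lemma gram_diag_zcomb b b' k n :
  tnth b' k = zcomb b n -> gram b' k k = zform (gram b) n.
Proof. by move=> E; rewrite zform_gram mxE E. Qed.

(** By induction on k, the first k vectors agree up to sign: the next vectors of
both bases have the same norm, each being a competitor in the minimality of the
other, so [tame_minimum] applies. The signs then agree by [tame_offdiag_gt0]. *)
Lemma tame_basis_unique b b' : tame_basis b -> tame_basis b' -> zspan b =i zspan b' ->
  b' = b \/ forall k, tnth b' k = - tnth b k.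
Proof.
move=> tb tb' bb'.
have [[fb [_ mb]] _] := tb; have [[fb' [ob' mb']] _] := tb'.
have tnth_span (c : 4.-tuple (quat R)) k : tnth c k \in zspan c.
  apply/zspanP; exists (delta_mx 0 k); rewrite (bigD1 k)//= big1 ?addr0.
    by rewrite mxE !eqxx scale1r.
  by move=> i ik; rewrite mxE (negbTE ik) scale0r.
have exU k : exists n, tnth b' k = zcomb b n.
  by apply/zspanP; rewrite bb'.
have exW k : exists n, tnth b k = zcomb b' n.
  by apply/zspanP; rewrite -bb'.
have [fU HU] := choice exU; have [fW HW] := choice exW.
pose U : 'M[int]_4 := \matrix_k fU k; pose W : 'M[int]_4 := \matrix_k fW k.
have UE k : tnth b' k = zcomb b (row k U) by rewrite rowK.
have WE k : tnth b k = zcomb b' (row k W) by rewrite rowK.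
have UW := base_change_inv UE WE fb'.
have WU := base_change_inv WE UE fb.
clearbody U W.
have main k : (k <= 4)%N -> signed_upto k U.
  elim: k => [//|k IH] k4.
  have sU := IH (ltnW k4).
  have sW := signed_upto_inv UW sU.
  pose ko := Ordinal k4.
  have pU : primitive_from ko (row ko U) := @signed_primitive _ _ ko UW sU.
  have pW : primitive_from ko (row ko W) := @signed_primitive _ _ ko WU sW.
  have E1 := gram_diag_zcomb (UE ko).
  have E2 := gram_diag_zcomb (WE ko).
  have eqn : zform (gram b) (row ko U) = gram b ko ko.
    apply/eqP; rewrite eq_le; apply/andP; split; last exact: mb.
    by rewrite -E1 E2; exact: mb'.
  have [H1 H2] := tame_minimum tb pU eqn.
  move=> j; rewrite ltnS leq_eqVlt => /orP[/eqP jk|]; last exact: sU.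
  have -> : j = ko by apply/val_inj.
  split; last by move: H2; rewrite mxE.
  by move=> i /H1; rewrite mxE.
have sU := main 4 (leqnn 4).
pose eps k := U k k.
have bE k : tnth b' k = (eps k)%:~R *: tnth b k.
  rewrite UE /zcomb (bigD1 k)//= big1 ?addr0 ?mxE// => i ik.
  have [U0 _] := sU k (ltn_ord k).
  by rewrite mxE U0// scale0r.
have epsP k : eps k = 1 \/ eps k = -1.
  by have [_] := sU k (ltn_ord k); rewrite -/(eps k) => ?; lia.
have step (k l : 'I_4) : l = k.+1 :> nat -> eps l = eps k.
  move=> lk; have := ob' k l lk; have := tame_offdiag_gt0 tb lk.
  rewrite !mxE !bE /qdot.
  under [in X in _ -> X -> _]eq_bigr do rewrite !mxE mulrACA.
  rewrite -mulr_sumr => g0; rewrite pmulr_lge0// -rmorphM /= ler0z.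
  by case: (epsP k) => ->; case: (epsP l) => ->.
have e1 : eps 1 = eps 0 by exact: step.
have e2 : eps 2 = eps 0 by rewrite -e1; exact: step.
have e3 : eps 3 = eps 0 by rewrite -e2; exact: step.
have eE : forall k, eps k = eps 0 by apply: ord4_ind.
case: (epsP 0) => e0; [left|right].
  by apply: eq_from_tnth => k; rewrite bE eE e0 scale1r.
by move=> k; rewrite bE eE e0 scaleN1r.
Qed.

Definition rmul_tuple b (c : quat R) : 4.-tuple (quat R) :=
  [tuple qmul (tnth b i) c | i < 4].

Lemma gram_rmul b c : gram (rmul_tuple b c) = qdot c c *: gram b.
Proof. by apply/matrixP => i j; rewrite !mxE !tnth_mktuple qdot_mulr mulrC. Qed.

Lemma free_rmul b c : c != 0 -> free b -> free (rmul_tuple b c).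
Proof.
move=> c0 /freeP fb; apply/freeP => k Hk; apply: fb.
have : qmul (\sum_(i < 4) k i *: tnth (rmul_tuple b c) i) (qinv c) = 0.
  by under eq_bigr do rewrite (tnth_nth 0); rewrite Hk q0mul.
rewrite qmul_suml; apply: etrans; apply: eq_bigr => i _.
by rewrite tnth_mktuple qmulZl -qmulA qmulV// qmul1 (tnth_nth 0).
Qed.

Lemma minkowski_reducedZ A s :
  0 < s -> minkowski_reduced A -> minkowski_reduced (s *: A).
Proof.
move=> s0 [H1 H2]; split => [k l kl|k n pn].
  by rewrite mxE mulr_ge0 ?(ltW s0)// H1.
by rewrite -/(zform _ n) zformZ [leLHS]mxE ler_pM2l//; exact: H2.
Qed.

Lemma reduced_rmul b c : c != 0 -> reduced_basis b -> reduced_basis (rmul_tuple b c).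
Proof.
move=> c0 [fb rb]; split; first exact: free_rmul.
rewrite gram_rmul; apply: minkowski_reducedZ => //.
by rewrite lt0r qdot_eq0 c0 qdot_ge0.
Qed.

(** Scaling by |c|^-2 maps a neighbourhood of the new Gram matrix to one of the old,
and it carries reduced Gram matrices to reduced ones. *)
Lemma tame_rmul b c : c != 0 -> tame_basis b -> tame_basis (rmul_tuple b c).
Proof.
move=> c0 tb; split; first by apply: reduced_rmul => //; case: tb.
have nb := tame_near tb.
have s0 : qdot c c != 0 by rewrite qdot_eq0.
suff : within symmetric_mx (nbhs (gram (rmul_tuple b c))) (@reduced_gram R).
  by rewrite (nbhs_subspace_in (gram_sym _)).
have cf : {for gram (rmul_tuple b c),
    continuous (fun B : 'M[R]_4 => (qdot c c)^-1 *: B)}.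
  exact: scaler_continuous.
have nb' : nbhs ((qdot c c)^-1 *: gram (rmul_tuple b c))
    [set B | B^T = B -> @reduced_gram R B].
  rewrite gram_rmul scalerA mulVf// scale1r; exact: nb.
have nB : \forall B \near gram (rmul_tuple b c),
    ((qdot c c)^-1 *: B)^T = (qdot c c)^-1 *: B ->
    @reduced_gram R ((qdot c c)^-1 *: B).
  exact: cf _ nb'.
apply: filterS nB => B HB sB.
have [b1 [rb1 B1]] : @reduced_gram R ((qdot c c)^-1 *: B).
  by apply: HB; rewrite linearZ /= sB.
exists (rmul_tuple b1 c); split; first exact: reduced_rmul.
by rewrite gram_rmul -B1 scalerA divff// scale1r.
Qed.

Lemma zspan_rmul b c x : c != 0 ->
  (x \in zspan (rmul_tuple b c)) = (qmul x (qinv c) \in zspan b).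
Proof.
move=> c0; apply/idP/idP => /zspanP[n E]; apply/zspanP; exists n.
  rewrite E qmul_suml; apply: eq_bigr => i _.
  by rewrite tnth_mktuple qmulZl -qmulA qmulV// qmul1.
rewrite -[x]qmul1 -(qmulVr c0) qmulA E qmul_suml; apply: eq_bigr => i _.
by rewrite tnth_mktuple qmulZl.
Qed.
End Minkowski.

(** * The moduli space of tame tori *)

Theorem theorem7p9 (R : realType) (L : zmodClosed 'rV[R]_4)
    (hL : rank4_lattice L) (hT : tame_torus L) :
  exists! v : 'rV[R]_4 * 'rV[R]_4 * 'rV[R]_4,
    tame_moduli v /\ equivalent_tori L (zspan (with_one v)).
Proof.
have rank4 (b : 4.-tuple (quat R)) : tame_basis b -> rank4_lattice (zspan b).
  by move=> [[fb _] _]; exists b; split.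
have [M [[b [[fb Mb] tb]] LM]] := hT.
have hM : rank4_lattice M by exists b.
have [a [a0 La Ma]] := (equivalent_toriP hL hM).1 LM.
(* L a = M, and M c has a tame basis b1 that starts with 1 *)
pose c := qinv (tnth b 0).
have b00 : tnth b 0 != 0.
  by rewrite (tnth_nth 0); apply: (free_not0 fb); rewrite mem_nth// size_tuple.
have c0 : c != 0 by exact: qinv_neq0.
pose b1 := rmul_tuple b c.
have tb1 : tame_basis b1 by exact: tame_rmul.
pose v := (tnth b1 1, tnth b1 2, tnth b1 3).
have vE : with_one v = b1.
  apply: eq_from_tnth; apply: ord4_ind => //.
  by rewrite [RHS]tnth_mktuple qmulV.
have tv : tame_moduli v.
  split; rewrite /special_moduli /= /special_basis vE; last exact: tb1.
  by split; [case: tb1|rewrite tnth_mktuple qmulV].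
exists v; split.
  split => //; apply/(equivalent_toriP hL); first by apply: rank4; rewrite vE.
  exists (qmul a c); split; first exact: qmul_neq0.
    move=> l Ll; rewrite vE zspan_rmul// -qmulA -qmulA qmulV// qmul1 -Mb; exact: La.
  move=> m; rewrite vE zspan_rmul// -Mb => Mm.
  by rewrite qinvM// qmulA; exact: Ma.
move=> w [[_ tw] Lw].
have [d [d0 Ld Wd]] := (equivalent_toriP hL (rank4 _ tw)).1 Lw.
(* as L (a c) and L d are the lattices of v and w, g maps the former to the latter *)
pose g := qmul (qinv (qmul a c)) d.
have ac0 : qmul a c != 0 by exact: qmul_neq0.
have g0 : g != 0 by apply: qmul_neq0 => //; exact: qinv_neq0.
have E : zspan (rmul_tuple b1 g) =i zspan (with_one w).
  have gi : qinv g = qmul (qinv d) (qmul a c).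
    by rewrite /g (qinvM (qinv_neq0 ac0) d0) (qinvK ac0).
  move=> x; rewrite (zspan_rmul b1 x g0) /b1 (zspan_rmul b _ c0) -Mb gi.
  have -> : qmul (qmul x (qmul (qinv d) (qmul a c))) (qinv c) =
      qmul (qmul x (qinv d)) a.
    by rewrite !qmulA -[X in X = _]qmulA qmulV// qmul1.
  apply/idP/idP => H.
    have := Ld _ (Ma _ H).
    by rewrite -qmulA -qmulA (qmulA a) qmulV// q1mul -qmulA qmulVr// qmul1.
  by apply: La; exact: Wd.
have tbg : tame_basis (rmul_tuple b1 g) by exact: tame_rmul.
have b10 : tnth b1 0 = qone by rewrite tnth_mktuple qmulV.
have w0 : tnth (with_one w) 0 = qone by [].
have res : with_one w = with_one v.
  rewrite vE; case: (tame_basis_unique tbg tw E) => H; apply: eq_from_tnth => k.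
    have g1 : g = qone.
      by have := congr1 (fun t => tnth t 0) H; rewrite w0 tnth_mktuple b10 q1mul.
    by rewrite H tnth_mktuple g1 qmul1.
  have g1 : g = - qone.
    by have := H 0; rewrite w0 tnth_mktuple b10 q1mul => ->; rewrite opprK.
  by rewrite H tnth_mktuple g1 qmulNr opprK qmul1.
have R1 := congr1 (fun t : 4.-tuple (quat R) => tnth t 1) res.
have R2 := congr1 (fun t : 4.-tuple (quat R) => tnth t 2) res.
have R3 := congr1 (fun t : 4.-tuple (quat R) => tnth t 3) res.
rewrite [w]surjective_pairing [w.1]surjective_pairing /v.
by congr (_, _, _); exact: esym.
Qed.
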